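(* Let $K$ be a field of characteristic $0$, let $t\ge 0$ be an integer, and let $I\subset S=K[x_1,\dots,x_n]$ be a $t$-spread strongly stable ideal. Then $I=(\operatorname{Gin}(I))^{\sigma^t}$. In particular, $\operatorname{Gin}(I)=I^{\tau^t}$ and $\operatorname{Gin}(I^{\sigma^t})=I$.
   Context: A monomial $x_{i_1}x_{i_2}\cdots x_{i_d}$ with $i_1\le i_2\le\cdots\le i_d$ is called $t$-spread if $i_j-i_{j-1}\ge t$ for $2\le j\le d$ (every monomial is $0$-spread). A $t$-spread monomial ideal is an ideal generated by $t$-spread monomials. For a monomial $u$, $\operatorname{supp}(u)=\{j : x_j \text{ divides } u\}$. A $t$-spread monomial ideal $I$ is called $t$-spread strongly stable if for all $t$-spread monomials $u\in I$, all $j\in\operatorname{supp}(u)$ and all $i<j$ such that $x_i(u/x_j)$ is $t$-spread, one has $x_i(u/x_j)\in I$. For $u=x_{i_1}\cdots x_{i_d}$ with $i_1\le\cdots\le i_d$ put $\sigma(u)=\prod_{j=1}^d x_{i_j+(j-1)}$; $\sigma^t$ is its $t$-fold iterate, a bijection from all monomials in $x_1,x_2,\dots$ to all $t$-spread monomials, with inverse $\tau^t$, the $t$-fold iterate of $\tau(u)=\prod_{j=1}^d x_{i_j-(j-1)}$. For a monomial ideal $I$, $I^{\sigma^t}$ is obtained by applying $t$ times the operation replacing an ideal by the ideal generated by the $\sigma(u)$ with $u$ in its unique minimal set of monomial generators; $I^{\tau^t}$ (for $I$ a $t$-spread ideal) is defined in the same way with $\tau$. $\operatorname{Gin}(I)$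 is the generic initial ideal of $I$ with respect to the reverse lexicographic order. Where the ideals live in polynomial rings with different numbers of variables, they are viewed in a common polynomial ring $K[x_1,\dots,x_N]$ with $N$ sufficiently large (i.e. identified by their minimal monomial generators).
   Formalization: The last equality Gin(I^{σ^t}) = I is proved for strongly stable (0-spread) I, since it fails for t-spread strongly stable I: with t = 1 and I = (x_1x_2), I^σ = (x_1x_3) and Gin(I^σ) = (x_1^2). *)

(* Defs.v *)
(* Mathematical Components, with multinomials for polynomials and the classical
   sets of MathComp-Analysis.  The paper's variable x_i is 'X_(i-1) here. *)
From mathcomp Require Export all_boot all_order all_algebra.
From mathcomp Require Export boolp classical_sets.
From mathcomp Require Export mpoly.

Set Implicit Arguments.
Unset Strict Implicit.
Unset Printing Implicit Defensive.

Import GRing.Theory.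
Local Open Scope classical_set_scope.
Local Open Scope ring_scope.

(* The indices i_1 <= ... <= i_d of m = x_{i_1} ... x_{i_d}, with multiplicity.
   This forgets n, so it is also how monomials in different numbers of variables
   are compared. *)
Definition indices n (m : 'X_{1..n}) : seq nat :=
  flatten [seq nseq (m i) (i : nat) | i <- enum 'I_n].

Definition tspread (t n : nat) (m : 'X_{1..n}) : bool :=
  sorted (fun i j => i + t <= j)%N (indices m).

(* The maps sigma and tau on index sequences.  Shifting all indices by one does
   not matter, and j here is the paper's j - 1.  The subtraction in [tau_seq] is
   truncated, but i_j >= j - 1 for a 1-spread monomial. *)
Definition sigma_seq (s : seq nat) : seq nat :=
  mkseq (fun j => nth 0 s j + j)%N (size s).

Definition tau_seq (s : seq nat) : seq nat :=
  mkseq (fun j => nth 0 s j - j)%N (size s).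

Section Ideals.
Variables (K : fieldType) (n : nat).
Implicit Types (I J A : set {mpoly K[n]}) (m u : 'X_{1..n}).

(* MathComp's [idealr_closed] only covers proper ideals. *)
Definition is_ideal I : Prop :=
  [/\ I 0, (forall f g, I f -> I g -> I (f + g))
    & (forall f g, I g -> I (f * g))].

Definition ideal_gen A : set {mpoly K[n]} := smallest is_ideal A.

Definition monomial_ideal (M : set 'X_{1..n}) : set {mpoly K[n]} :=
  ideal_gen [set 'X_[m] | m in M].

(* The minimal monomial generators of a monomial ideal are its monomials which
   are minimal for divisibility, written (_ <= _)%MM. *)
Definition min_gens I : set 'X_{1..n} :=
  [set m | I 'X_[m] /\ forall u, I 'X_[u] -> (u <= m)%MM -> u = m].

Definition tspread_ideal (t : nat) I : Prop :=
  exists2 M : set 'X_{1..n},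
    (forall m, M m -> tspread t m) & I = monomial_ideal M.

Definition tspread_strongly_stable (t : nat) I : Prop :=
  tspread_ideal t I /\
  forall u (i j : 'I_n),
    tspread t u -> I 'X_[u] -> (0 < u j)%N -> (i < j)%N ->
    tspread t (u - U_(j) + U_(i))%MM -> I 'X_[(u - U_(j) + U_(i))%MM].

(* The degree reverse lexicographic order induced by x_1 > ... > x_n.  The
   order on 'X_{1..n} in the library (and hence [mlead]) is, despite its
   documentation, the degree lexicographic one. *)
Definition revlex_lt m u : bool :=
  (mdeg m < mdeg u)%N ||
  (mdeg m == mdeg u) &&
  [exists i : 'I_n, (u i < m i)%N &&
                    [forall j : 'I_n, (i < j)%N ==> (m j == u j)]].

Definition initial_monomial (f : {mpoly K[n]}) m : Prop :=
  m \in msupp f /\ forall u, u \in msupp f -> u != m -> revlex_lt u m.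

Definition initial_ideal I : set {mpoly K[n]} :=
  monomial_ideal [set m | exists2 f, I f & initial_monomial f m].

(* The linear change of coordinates x_j |-> \sum_i g_(i, j) x_i. *)
Definition lin_subst (g : 'M[K]_n) (f : {mpoly K[n]}) : {mpoly K[n]} :=
  f \mPo [tuple \sum_(i < n) g i j *: 'X_i | j < n].

(* Zariski open subsets of GL_n(K): those where some member of a family of
   polynomials in the n * n matrix entries does not vanish. *)
Definition zariski_open (U : set 'M[K]_n) : Prop :=
  exists P : set {mpoly K[n * n]},
    U = [set g | g \in unitmx /\ exists2 p, P p & p.@[mxvec g 0] != 0].

Definition is_gin I J : Prop :=
  exists U : set 'M[K]_n,
    [/\ zariski_open U, U !=set0
      & forall g, U g -> initial_ideal (lin_subst g @` I) = J].

(* For K infinite there is at most one J with [is_gin I J], since two nonempty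
   open subsets of GL_n(K) meet.  The default value set0 is not an ideal. *)
Definition Gin I : set {mpoly K[n]} := xget set0 [set J | is_gin I J].

End Ideals.

(* The ideal of K[x_1, ..., x_N] generated by the phi(u), u a minimal monomial
   generator of I.  A phi(u) which does not fit into N variables is lost, so N
   has to be large enough. *)
Definition map_gens (K : fieldType) n (phi : seq nat -> seq nat) (N : nat)
    (I : set {mpoly K[n]}) : set {mpoly K[N]} :=
  monomial_ideal
    [set m : 'X_{1..N} | exists2 u, min_gens I u & indices m = phi (indices u)].
Arguments map_gens {K n} phi N I.

(* The monomial ideal I viewed in K[x_1, ..., x_N]. *)
Definition in_vars (K : fieldType) n (N : nat)
    (I : set {mpoly K[n]}) : set {mpoly K[N]} :=
  map_gens id N I.
Arguments in_vars {K n} N I.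

Definition sigma_ideal (K : fieldType) N (t : nat)
    (I : set {mpoly K[N]}) : set {mpoly K[N]} :=
  iter t (map_gens sigma_seq N) I.

Definition tau_ideal (K : fieldType) N (t : nat)
    (I : set {mpoly K[N]}) : set {mpoly K[N]} :=
  iter t (map_gens tau_seq N) I.

(* Main.v *)
Require Import Defs.
From mathcomp Require Import all_boot all_order all_algebra.
From mathcomp Require Import boolp classical_sets.
From mathcomp Require Import mpoly.
From mathcomp Require Import zify.

(* Let G be the minimal generators of a t-spread strongly stable ideal I, and J
   the ideal generated by tau^t(G).  For a generic linear change of coordinates
   phi we show that J is contained in in(phi I) and that, in each degree, J has at
   least as many monomials as I; since phi I has as many initial monomials as I
   has monomials, in(phi I) = J.

   For the inclusion, let u = u' x_b be a t-spread monomial of degree d in I and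
   k = b - (d - 1)t.  Working modulo x_{k+1}, ..., x_n, one shows by induction on
   w that x_i phi(w) lies in phi(I) for every i and every t-spread w bounded by
   u' componentwise: for the indices c <= b outside the blocks [j, j + t - 1], j
   in supp(w), either w x_c is t-spread, hence in I, or w x_c = x_j w' with a
   smaller w'; there are k such c, and the forms phi(x_c) of k generic variables
   span the linear forms in x_1, ..., x_k.  Hence a combination of the phi(w) with
   initial monomial tau^t(u') gives, after multiplication by x_k, an element of
   phi(I) with initial monomial tau^t(u') x_k = tau^t(u).

   For the count, every monomial of I is uniquely a product of a generator u,
   extracted greedily, and a monomial in the n - max(tau^t(u)) + 1 variables which
   are at least max(u) or lie in a block of u; these variables are matched with
   those from max(tau^t(u)) on. *)

Set Implicit Arguments.
Unset Strict Implicit.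
Unset Printing Implicit Defensive.

Import GRing.Theory.
Local Open Scope classical_set_scope.
Local Open Scope nat_scope.

(** * Spread index sequences *)

Definition spread (t : nat) (s : seq nat) : bool :=
  sorted (fun i j => i + t <= j) s.

(** The sizes agree, so past the end both sides take the default [0] and the bound over all [i] says
    nothing there. *)
Definition cwle (s1 s2 : seq nat) : Prop :=
  size s1 = size s2 /\ forall i, nth 0 s1 i <= nth 0 s2 i.

Lemma spreadP t s :
  reflect (forall i, i.+1 < size s -> nth 0 s i + t <= nth 0 s i.+1)
          (spread t s).
Proof. exact: sortedP. Qed.

Lemma spread_sorted t s : spread t s -> sorted leq s.
Proof. by apply: sub_sorted => i j /=; lia. Qed.

Lemma spread_take t k s : spread t s -> spread t (take k s).
Proof. exact: take_sorted. Qed.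

Lemma spread_gap t s i j :
  spread t s -> i <= j -> j < size s -> nth 0 s i + (j - i) * t <= nth 0 s j.
Proof.
move=> /spreadP st; elim: j => [|j IH] ij js; first by
  (have -> : i = 0 by lia); rewrite addn0.
have [->|ne] := eqVneq i j.+1; first by rewrite subnn; lia.
have := st _ js; have := IH ltac:(lia) ltac:(lia).
by rewrite subSn ?mulSn; lia.
Qed.

Lemma cwle_refl s : cwle s s. Proof. by []. Qed.

Lemma cwle_trans s2 s1 s3 : cwle s1 s2 -> cwle s2 s3 -> cwle s1 s3.
Proof.
by move=> [e1 l1] [e2 l2]; split=> [|i]; [rewrite e1|apply: leq_trans (l2 i)].
Qed.

Lemma cwle_cons x y s s' : x <= y -> cwle s s' -> cwle (x :: s) (y :: s').
Proof. by move=> xy [e l]; split=> [|[]] //=; rewrite e. Qed.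

Lemma cwle_take k s s' : cwle s s' -> cwle (take k s) (take k s').
Proof.
move=> [e l]; split=> [|i]; first by rewrite !size_take e.
case: (ltnP i k) => ik; first by rewrite !nth_take.
by rewrite !nth_default // size_take; case: ifP; lia.
Qed.

Lemma cwle_bounded n s s' :
  cwle s s' -> all (fun i => i < n) s' -> all (fun i => i < n) s.
Proof.
move=> [e l] /(all_nthP 0) h; apply/(all_nthP 0) => i; rewrite e => /h.
exact: leq_ltn_trans.
Qed.

(** The entry at position [j] of a subsequence sits at position [j] or later in [s'], so by
    sortedness it is at least the entry of [s'] at [j]. *)
Lemma subseq_cwle s s' :
  sorted leq s' -> subseq s s' -> cwle (take (size s) s') s.
Proof.
elim: s' s => [|y s' IH] [|x s] //= p; [by []..|].
have ss := path_sorted p.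
case: eqP => [<-|_] h; first by apply: cwle_cons => //; apply: IH.
have yx : y <= x.
  have /(order_path_min leq_trans)/allP := p; apply.
  by rewrite (mem_subseq h) // mem_head.
apply: cwle_cons => //; apply: IH => //.
exact: subseq_trans (subseq_cons _ _) h.
Qed.

Definition blocks t s : seq nat := flatten [seq iota i t | i <- s].

Lemma size_blocks t s : size (blocks t s) = size s * t.
Proof. by elim: s => //= i s; rewrite /blocks /= size_cat size_iota mulSn => ->. Qed.

Lemma mem_blocks t s c :
  reflect (exists2 i, i \in s & i <= c < i + t) (c \in blocks t s).
Proof.
apply: (iffP flatten_mapP) => [[i si ci]|[i si ci]]; exists i => //;
  by rewrite mem_iota in ci *.
Qed.

(* g takes greedily the smallest next entry allowed; the entries skipped on the
   way, which form r, then lie in the blocks of g. *)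
Lemma greedy_spread t w p : sorted leq w ->
  exists g r, [/\ perm_eq w (g ++ r),
    spread t g /\ {in g, forall c, p <= c},
    (forall c, c \in r -> c < p \/ c \in blocks t g) &
    forall s, spread t s -> {in s, forall c, p <= c} -> subseq s w ->
      cwle (take (size s) g) s].
Proof.
elim: w p => [|x w IH] p.
  move=> _; exists [::], [::]; split=> // s _ _; rewrite subseq0 => /eqP->.
  by split.
move=> /= xw; have sw := path_sorted xw.
have [px|xp] := leqP p x; last first.
  have [g [r [pe [sg gp] rb gmin]]] := IH p sw; exists g, (x :: r); split=> //.
  - by rewrite perm_sym perm_catC /= perm_cons perm_catC perm_sym.
  - by move=> c; rewrite inE => /orP[/eqP->|/rb//]; left.
  - move=> [|y s] sp ps; first by move=> _; split; rewrite take0.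
    case: eqP => [yx|_]; last exact: gmin.
    by have := ps y (mem_head _ _); lia.
(* Here [x] is taken, so the lower bound for the next entry becomes [x + t]. *)
have [g [r [pe [sg gp] rb gmin]]] := IH (x + t) sw.
exists (x :: g), r; split.
- by rewrite /= perm_cons.
- split; first by case: g sg gp {rb gmin pe} => //= y g -> /(_ y (mem_head _ _)) ->.
  by move=> c; rewrite inE => /orP[/eqP->//|/gp]; lia.
- move=> c cr; have xc : x <= c.
    have /(order_path_min leq_trans)/allP := xw; apply.
    by rewrite (perm_mem pe) mem_cat cr orbT.
  right; apply/mem_blocks; case: (rb c cr) => [h|/mem_blocks[i gi ci]].
    by exists x; rewrite ?mem_head // xc.
  by exists i; rewrite // inE gi orbT.
- move=> [|y s] sp ps sub; first by split; rewrite take0.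
  have xy : x <= y.
    have /mem_subseq/(_ y (mem_head _ _)) : subseq (y :: s) (x :: w) by [].
    rewrite inE => /orP[/eqP->//|].
    by have /(order_path_min leq_trans)/allP := xw; apply.
  apply: cwle_cons => //; apply: gmin; first exact: path_sorted sp.
    move=> c cs; have /order_path_min/allP : path (fun i j => i + t <= j) y s by [].
    have tr : transitive (fun i j => i + t <= j) by move=> ? ? ?; lia.
    by move=> /(_ tr c cs); apply: leq_trans; lia.
  move: sub => /=; case: eqP => // _ sub.
  exact: subseq_trans (subseq_cons _ _) sub.
Qed.
Lemma path_spread t x s :
  path (fun i j => i + t <= j) x s = all (fun j => x + t <= j) s && spread t s.
Proof. by apply: path_sortedE => ? ? ?; lia. Qed.

(** Outside the blocks, [c] is at least [t] above every entry that does not exceed it. So it either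
    fits at the end or can replace the first entry [y] exceeding it, which keeps the sequence spread
    and lowers its sum. *)
Lemma swap_smaller t s c : spread t s -> c \notin blocks t s ->
  spread t (rcons s c) \/
  exists y w, [/\ perm_eq (y :: w) (c :: s), spread t w, cwle w s
    & (sumn w < sumn s)].
Proof.
elim: s => [|x s IH] /=; first by left.
rewrite /spread /= !path_spread => /andP[xs ss].
rewrite /blocks /= mem_cat mem_iota negb_or => /andP[cx cs].
have [cltx|xc] := ltnP c x.
  right; exists x, (c :: s); split; [|..|by rewrite /=; lia].
  - by rewrite -cat1s -[c :: s]cat1s perm_catCA.
  - rewrite /spread /= path_spread ss andbT; apply: sub_all xs => j; lia.
  - by apply: cwle_cons => //; lia.
have xtc : (x + t <= c) by lia.
case: (IH ss cs) => [src|[y [w [pe sw le sm]]]].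
  by left; rewrite all_rcons xtc xs.
right; exists y, (x :: w); split; [|..|by rewrite /=; lia].
- by rewrite -cat1s -[x :: w]cat1s perm_catCA -[c :: _]cat1s -[x :: s]cat1s
    perm_sym perm_catCA perm_cat2l perm_sym.
- rewrite /spread /= path_spread sw andbT; apply/allP => j jw.
  have : j \in c :: s by rewrite -(perm_mem pe) inE jw orbT.
  by rewrite inE => /orP[/eqP->//|/(allP xs)].
- exact: cwle_cons.
Qed.

Lemma nth_rcons_size (T : Type) (x0 : T) s x : nth x0 (rcons s x) (size s) = x.
Proof. by rewrite nth_rcons ltnn eqxx. Qed.

(** * The shifts sigma and tau on sequences *)

Lemma size_tau s : size (tau_seq s) = size s. Proof. exact: size_mkseq. Qed.
Lemma size_sigma s : size (sigma_seq s) = size s. Proof. exact: size_mkseq. Qed.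

Lemma nth_tau s i : nth 0 (tau_seq s) i = nth 0 s i - i.
Proof.
have [si|si] := leqP (size s) i; last exact: nth_mkseq.
by rewrite !nth_default ?size_tau.
Qed.

Lemma nth_sigma s i : i < size s -> nth 0 (sigma_seq s) i = nth 0 s i + i.
Proof. exact: nth_mkseq. Qed.

Lemma spread_tau t s : spread t.+1 s -> spread t (tau_seq s).
Proof.
move=> st; apply/spreadP => i; rewrite size_tau !nth_tau => h.
have /spreadP/(_ i h) := st.
(* The gap from position [0] gives [i <= nth 0 s i], so the truncated subtraction is exact. *)
by have := spread_gap st (leq0n i) (ltnW h); rewrite mulnS; lia.
Qed.

Lemma spread_sigma t s : spread t s -> spread t.+1 (sigma_seq s).
Proof.
move=> /spreadP st; apply/spreadP => i; rewrite size_sigma => h.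
by rewrite !nth_sigma; have := st _ h; lia.
Qed.

Lemma tau_sigma s : tau_seq (sigma_seq s) = s.
Proof.
apply: (@eq_from_nth _ 0) => [|i]; rewrite size_tau size_sigma // => h.
by rewrite nth_tau nth_sigma // addnK.
Qed.

Lemma sigma_tau t s : spread t.+1 s -> sigma_seq (tau_seq s) = s.
Proof.
move=> st; apply: (@eq_from_nth _ 0) => [|i]; rewrite size_sigma size_tau // => h.
rewrite nth_sigma ?size_tau // nth_tau subnK //.
by have := spread_gap st (leq0n i) h; rewrite mulnS; lia.
Qed.

Lemma take_tau k s : tau_seq (take k s) = take k (tau_seq s).
Proof.
apply: (@eq_from_nth _ 0) => [|i].
  by rewrite size_tau !size_take size_tau.
rewrite size_tau nth_tau size_take_min leq_min => /andP[ik _].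
by rewrite !nth_take // nth_tau.
Qed.

Lemma take_sigma k s : sigma_seq (take k s) = take k (sigma_seq s).
Proof.
apply: (@eq_from_nth _ 0) => [|i]; rewrite size_sigma.
  by rewrite !size_take size_sigma.
move=> h; rewrite nth_sigma //; move: h; rewrite size_take_min leq_min => /andP[ik si].
by rewrite !nth_take // nth_sigma.
Qed.

Lemma cwle_tau s s' : cwle s s' -> cwle (tau_seq s) (tau_seq s').
Proof.
by move=> [e l]; split=> [|i]; rewrite ?size_tau ?nth_tau ?leq_sub2r.
Qed.

Lemma bounded_sigma n s :
  all (fun i => i < n) (sigma_seq s) -> all (fun i => i < n) s.
Proof.
move=> /(all_nthP 0) h; apply/(all_nthP 0) => i is_.
by have := h i; rewrite size_sigma nth_sigma // => /(_ is_); lia.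
Qed.

Lemma bounded_tau n s :
  all (fun i => i < n) s -> all (fun i => i < n) (tau_seq s).
Proof.
move=> /(all_nthP 0) h; apply/(all_nthP 0) => i; rewrite size_tau nth_tau.
by move=> /h; lia.
Qed.

Lemma bounded_iter_tau n t s :
  all (fun i => i < n) s -> all (fun i => i < n) (iter t tau_seq s).
Proof. by move=> bs; elim: t => //= t; apply: bounded_tau. Qed.

Lemma nth_iter_tau t s i : nth 0 (iter t tau_seq s) i = nth 0 s i - i * t.
Proof.
by elim: t => [|t IH]; rewrite ?muln0 ?subn0 // iterS nth_tau IH mulnS; lia.
Qed.

Lemma size_iter_tau t s : size (iter t tau_seq s) = size s.
Proof. by elim: t => //= t; rewrite size_tau. Qed.

Lemma take_iter_tau t k s :
  iter t tau_seq (take k s) = take k (iter t tau_seq s).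
Proof. by elim: t => //= t ->; rewrite take_tau. Qed.

Lemma spread_iter_tau t s : spread t s -> sorted leq (iter t tau_seq s).
Proof.
elim: t s => [|t IH] s; first exact: spread_sorted.
by rewrite iterSr => /spread_tau/IH.
Qed.

Lemma iter_sigma_tau t s : spread t s -> iter t sigma_seq (iter t tau_seq s) = s.
Proof.
elim: t s => // t IH s st; rewrite iterS iterSr IH ?(sigma_tau st) //.
exact: spread_tau.
Qed.

Lemma iter_tau_sigma t s : iter t tau_seq (iter t sigma_seq s) = s.
Proof. by elim: t => // t IH; rewrite iterSr iterS tau_sigma. Qed.

Lemma iter_tau_rcons t s x :
  iter t tau_seq (rcons s x) = rcons (iter t tau_seq s) (x - size s * t).
Proof.
apply: (@eq_from_nth _ 0) => [|i]; first by rewrite size_rcons !size_iter_tau size_rcons.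
rewrite size_iter_tau size_rcons ltnS nth_iter_tau !nth_rcons size_iter_tau.
by case: ltngtP => // [|->]; rewrite ?nth_iter_tau.
Qed.

(* What the index sequences of the minimal generators of a t-spread strongly
   stable ideal satisfy. *)
Definition stable_gens (t : nat) (G : set (seq nat)) : Prop :=
  [/\ forall s, G s -> spread t s,
      forall s s', G s -> cwle s' s -> spread t s' -> exists k, G (take k s')
    & forall s k, G s -> G (take k s) -> take k s = s].

(** A sequence below [tau_seq s] is lifted by [sigma_seq] to one below [s]. Both shifts commute with
    taking prefixes and are mutually inverse on the sequences involved, so prefixes in [G] go back
    and forth. *)
Lemma stable_gens_tau t G :
  stable_gens t.+1 G -> stable_gens t (tau_seq @` G).
Proof.
move=> [Gt Gle Gp]; split=> [_ [s /Gt/spread_tau ? <-] //|_ s' [s Gs <-]|_ k [s Gs <-]].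
  move=> le st; have [k Gk] : exists k, G (take k (sigma_seq s')).
    apply: (Gle s) => //; last exact: spread_sigma.
    move: le => [e l]; split=> [|i]; first by rewrite size_sigma e size_tau.
    have [si|si] := leqP (size s') i; first by rewrite nth_default ?size_sigma.
    rewrite -[s in leqRHS](sigma_tau (Gt _ Gs)) !nth_sigma -?e //.
    by have := l i; lia.
  by exists k, (take k (sigma_seq s')); rewrite // take_tau tau_sigma.
move=> [s2 Gs2]; rewrite -take_tau => e; congr tau_seq; apply: Gp => //.
suff -> : take k s = s2 by [].
rewrite -[s2](sigma_tau (Gt _ Gs2)) e (@sigma_tau t) //.
by apply: spread_take; apply: Gt.
Qed.

Lemma stable_gens_sigma t G :
  stable_gens t G -> stable_gens t.+1 (sigma_seq @` G).
Proof.
move=> [Gt Gle Gp]; split=> [_ [s /Gt/spread_sigma ? <-] //|_ s' [s Gs <-]|_ k [s Gs <-]].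
  move=> le st; have [k Gk] : exists k, G (take k (tau_seq s')).
    apply: (Gle s) => //; last exact: spread_tau.
    by rewrite -(tau_sigma s); apply: cwle_tau.
  by exists k, (take k (tau_seq s')); rewrite // take_sigma (sigma_tau st).
move=> [s2 Gs2]; rewrite -take_sigma => /(congr1 tau_seq).
rewrite !tau_sigma => e; rewrite -e; congr sigma_seq; rewrite e.
by apply: Gp; rewrite -?e.
Qed.

Lemma stable_gens_iter_tau t G :
  stable_gens t G -> stable_gens 0 (iter t tau_seq @` G).
Proof.
elim: t G => [|t IH] G GG; first by rewrite image_id.
have -> : iter t.+1 tau_seq = iter t tau_seq \o tau_seq.
  by apply/funext => s; rewrite iterSr.
by rewrite -image_comp; apply: IH; apply: stable_gens_tau.
Qed.

Lemma stable_gens_iter_sigma t G :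
  stable_gens 0 G -> stable_gens t (iter t sigma_seq @` G).
Proof.
elim: t => [|t IH] /= GG; first by rewrite image_id.
by have := stable_gens_sigma (IH GG); rewrite image_comp.
Qed.

(** * Monomials as index sequences *)

Section Monomials.
Variable n : nat.
Implicit Types (m : 'X_{1..n}) (s : seq nat).

Local Notation bounded := (all (fun i => i < n)).

(** Unsorted sequences are accepted, so that multiplication is concatenation. Entries that are at
    least [n] are silently dropped, hence the boundedness hypotheses below. *)
Definition mon s : 'X_{1..n} := [multinom count_mem (i : nat) s | i < n].

Lemma mon_cat s s' : mon (s ++ s') = (mon s + mon s')%MM.
Proof. by apply/mnmP => i; rewrite !mnmE count_cat. Qed.

Lemma mon_perm s s' : perm_eq s s' -> mon s = mon s'.
Proof. by move=> /permP e; apply/mnmP => i; rewrite !mnmE e. Qed.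

Lemma mon_ord (i : 'I_n) : mon [:: i : nat] = U_(i)%MM.
Proof. by apply/mnmP => j; rewrite !mnmE /= addn0 -val_eqE. Qed.

Lemma mon_nil : mon [::] = 0%MM.
Proof. by apply/mnmP => j; rewrite !mnmE. Qed.

Lemma leq_count_mon s s' : bounded s -> (mon s <= mon s')%MM ->
  forall i, count_mem i s <= count_mem i s'.
Proof.
move=> bs /mnm_lepP le i; have [si|/count_memPn-> //] := boolP (i \in s).
by have := le (Ordinal (allP bs i si)); rewrite !mnmE.
Qed.

Lemma mon_inj s s' : bounded s -> bounded s' -> mon s = mon s' -> perm_eq s s'.
Proof.
move=> bs bs' e; apply/allP => i _ /=; rewrite eqn_leq.
by rewrite !leq_count_mon // e lepm_refl.
Qed.

Lemma subseq_mon s s' : subseq s s' -> (mon s <= mon s')%MM.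
Proof. by move=> ss; apply/mnm_lepP => i; rewrite !mnmE leq_count_subseq. Qed.

(** Divisibility only compares multiplicities; it yields a subsequence of [s'] that permutes [s],
    and sortedness identifies the two. *)
Lemma mon_subseq s s' : bounded s -> sorted leq s -> sorted leq s' ->
  (mon s <= mon s')%MM -> subseq s s'.
Proof.
move=> bs ss ss' /(leq_count_mon bs)/count_subseqP[s2 sub pe].
suff -> : s = s2 by [].
apply: (sorted_eq leq_trans anti_leq) => //.
exact: subseq_sorted leq_trans _ _ sub ss'.
Qed.

Lemma count_indices m (i : 'I_n) : count_mem (i : nat) (indices m) = m i.
Proof.
rewrite /indices count_flatten sumnE -map_comp big_map big_enum /=.
rewrite (bigD1 i) //= big1 ?addn0 => [|j ji]; rewrite count_nseq /=.
  by rewrite eqxx mul1n.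
by rewrite val_eqE (negPf ji).
Qed.

Lemma indicesK m : mon (indices m) = m.
Proof. by apply/mnmP => i; rewrite mnmE count_indices. Qed.

Lemma indices_bounded m : bounded (indices m).
Proof.
by apply/allP => _ /flatten_mapP[i _ /nseqP[-> _]].
Qed.

Lemma indices_sorted m : sorted leq (indices m).
Proof.
rewrite sorted_pairwise ?/indices; last exact: leq_trans.
have : pairwise ltn (map val (enum 'I_n)).
  by rewrite -sorted_pairwise; [rewrite val_enum_ord iota_ltn_sorted|exact: ltn_trans].
elim: (enum _) => //= i l IH /andP[il /IH h]; rewrite pairwise_cat h andbT.
apply/andP; split; last first.
  by elim: (m i) => //= k ->; rewrite andbT; apply/allP => j /nseqP[-> _].
apply/allrelP => _ y /nseqP[-> _] /flatten_mapP[j jl /nseqP[-> _]].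
by apply/ltnW/(allP il); apply: map_f.
Qed.

Lemma monK s : sorted leq s -> bounded s -> indices (mon s) = s.
Proof.
move=> ss bs; apply: (sorted_eq leq_trans anti_leq) => //.
  exact: indices_sorted.
by apply: mon_inj; rewrite ?indices_bounded // indicesK.
Qed.

Lemma mdeg_mon s : bounded s -> mdeg (mon s) = size s.
Proof.
elim: s => [|x s IH] /=; first by rewrite mon_nil mdeg0.
by move=> /andP[xn bs]; rewrite -cat1s mon_cat mdegD IH // (mon_ord (Ordinal xn)) mdeg1.
Qed.

Lemma size_indices m : size (indices m) = mdeg m.
Proof. by rewrite -(mdeg_mon (indices_bounded m)) indicesK. Qed.

End Monomials.

(** * Monomial ideals *)

Section MonomialIdeals.
Variables (K : fieldType) (n : nat).
Implicit Types (I : set {mpoly K[n]}) (M : set 'X_{1..n}) (G : set (seq nat)).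

Local Notation bounded := (all (fun i => i < n)).

Lemma ideal_gen_is_ideal (A : set {mpoly K[n]}) : is_ideal (ideal_gen A).
Proof.
split=> [|f g If Ig|f g Ig] B hB; case: (hB) => -[B0 BD BM] _ //.
- exact: BD (If _ hB) (Ig _ hB).
- exact: BM (Ig _ hB).
Qed.

Lemma is_ideal_sum I (T : Type) (r : seq T) (P : pred T) (F : T -> {mpoly K[n]}) :
  is_ideal I -> (forall i, P i -> I (F i)) -> I (\sum_(i <- r | P i) F i)%R.
Proof. by move=> [I0 ID _] IF; apply: big_ind. Qed.

Lemma is_idealZ I c f : is_ideal I -> I f -> I (c *: f)%R.
Proof. by move=> [_ _ IM] If; rewrite -mul_mpolyC; apply: IM. Qed.

(** The right-hand side is itself an ideal containing the generators; conversely, each [f] in it is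
    the sum of its terms, all multiples of generators. *)
Lemma monomial_idealE M : @monomial_ideal K n M =
  [set f | forall m, m \in msupp f -> exists2 u, M u & (u <= m)%MM].
Proof.
apply/seteqP; split=> [|f Mf].
  apply: smallest_sub; last first.
    by move=> _ [u Mu <-] m /mem_msuppXP <-; exists u => //; apply: lepm_refl.
  split=> [m|f g Hf Hg m|f g Hg m]; first by rewrite msupp0.
    by move=> /msuppD_le; rewrite mem_cat => /orP[/Hf|/Hg].
  move=> /msuppM_le/allpairsP[[u v] /= [_ /Hg[w Mw wv] ->]].
  by exists w => //; apply: lepm_trans wv (lem_addl _ _).
have idM := ideal_gen_is_ideal [set 'X_[m]%R | m in M].
rewrite (mpolyE f) big_seq; apply: (is_ideal_sum _ idM) => m /Mf[u Mu um].
apply: (is_idealZ _ idM); rewrite -(submK um) mpolyXD.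
by have [_ _ IM] := idM; apply: IM; apply: sub_gen_smallest; exists u.
Qed.

Lemma monomial_idealX M m :
  @monomial_ideal K n M 'X_[m]%R <-> exists2 u, M u & (u <= m)%MM.
Proof.
rewrite monomial_idealE /=; split=> [|h u /mem_msuppXP <-//].
by apply; apply/mem_msuppXP.
Qed.

Lemma monomial_ideal_up I m u : is_ideal I ->
  I 'X_[m]%R -> (m <= u)%MM -> I 'X_[u]%R.
Proof. by move=> [_ _ IM] Im mu; rewrite -(submK mu) mpolyXD; apply: IM. Qed.

(** Induction on the degree: a monomial of [I] that is not minimal has a divisor of smaller degree
    in [I]. *)
Lemma min_gens_exist I m : I 'X_[m]%R -> exists2 u, min_gens I u & (u <= m)%MM.
Proof.
have [d] := ubnP (mdeg m); elim: d m => // d IH m md Im.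
have [h|] := pselect (min_gens I m); first by exists m => //; apply: lepm_refl.
move=> /not_andP[//|/existsNP[u /not_implyP[Iu /not_implyP[um ne]]]].
have [|//|v Iv vu] := IH u; last by exists v => //; apply: lepm_trans vu um.
have e := submK um; have : mdeg m = mdeg (m - u + u)%MM by rewrite e.
rewrite mdegD => em; suff : 0 < mdeg (m - u)%MM by lia.
rewrite lt0n mdeg_eq0; apply/eqP => m0; apply: ne.
by rewrite -e m0 add0m.
Qed.

(** The generators are recorded as sequences, which do not mention [n]; passing to another number of
    variables then leaves [G] unchanged. *)
Definition gens_ideal G : set {mpoly K[n]} := monomial_ideal (mon n @` G).

Lemma gens_idealX G m : sorted leq m -> (forall s, G s -> sorted leq s) ->
  (forall s, G s -> bounded s) ->
  (gens_ideal G 'X_[mon n m]%R <-> exists2 s, G s & subseq s m).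
Proof.
move=> sm Gs Gb; rewrite /gens_ideal monomial_idealX; split=> [[_ [s ? <-]]|[s ? sub]].
  by exists s => //; apply: mon_subseq; [apply: Gb|apply: Gs|..].
by exists (mon n s); [exists s|apply: subseq_mon].
Qed.

(** The generators form an antichain: if [s] divides [s'], the prefix of [s'] of length [size s]
    lies below [s], so a prefix of it is in [G]. By prefix-freeness that prefix is all of [s'], and
    [s'] is no longer than [s]. *)
Lemma min_gens_gens_ideal t G : stable_gens t G -> (forall s, G s -> bounded s) ->
  min_gens (gens_ideal G) = mon n @` G.
Proof.
move=> [Gt Gle Gp] Gb; have Gs s : G s -> sorted leq s.
  by move=> /Gt; apply: spread_sorted.
have G_anti s s' : G s -> G s' -> (mon n s <= mon n s')%MM -> s = s'.
  move=> Gss Gss' /(mon_subseq (Gb _ Gss) (Gs _ Gss) (Gs _ Gss')) sub.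
  have le := subseq_cwle (Gs _ Gss') sub.
  have [k] := Gle _ _ Gss le (spread_take _ (Gt _ Gss')).
  rewrite -take_min => /(Gp _ _ Gss') e.
  have sz : size s' <= size s.
    have /eqP := congr1 size e; rewrite size_take_min => /eqP/minn_idPr.
    by rewrite leq_min => /andP[].
  apply/eqP; rewrite -(size_subseq_leqif sub) eqn_leq sz andbT.
  exact: size_subseq.
apply/seteqP; split=> [m [/monomial_idealX[u Gu um] mmin]|_ [s Gss <-]].
  suff <- : u = m by [].
  apply: mmin => //; apply/monomial_idealX; exists u => //; exact: lepm_refl.
split=> [|u].
  by apply/monomial_idealX; exists (mon n s); [exists s|exact: lepm_refl].
move=> /monomial_idealX[_ [s' Gs' <-] le] us.
have e := G_anti _ _ Gs' Gss (lepm_trans le us).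
apply/mnmP => i; apply/eqP; rewrite eqn_leq.
by rewrite e in le; rewrite (mnm_lepP le) (mnm_lepP us).
Qed.

(* t-spread Borel moves turn s into s' one entry at a time, from the left. *)
Lemma strongly_stable_cwle t I s s' : tspread_strongly_stable t I ->
  bounded s -> spread t s -> spread t s' -> cwle s' s ->
  I 'X_[mon n s]%R -> I 'X_[mon n s']%R.
Proof.
move=> [_ stI] bs ss ss' [es le] Is.
suff H p : p <= size s ->
    spread t (take p s' ++ drop p s) /\ I 'X_[mon n (take p s' ++ drop p s)]%R.
  by have [_] := H _ (leqnn _); rewrite drop_size cats0 -es take_size.
elim: p => [|p IH] ps; first by rewrite take0 drop0.
have [sp Ip] := IH (ltnW ps).
have ps' : p < size s' by rewrite es.
have szt : size (take p s') = p by rewrite size_takel // ltnW.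
have sp' : spread t (take p.+1 s' ++ drop p.+1 s).
  have szt' : size (take p.+1 s') = p.+1 by rewrite size_takel.
  apply/spreadP => i; rewrite size_cat size_drop szt' !nth_cat szt' !nth_drop => hi.
  have [i1|i1] := ltnP i.+1 p.+1.
    have i0 : i < p.+1 by lia.
    by rewrite i0 !nth_take //; move/spreadP: ss'; apply; lia.
  (* At the junction [i = p] the left entry is at most that of [s] and the right one is still that
     of [s], so the gap has not shrunk. *)
  have [i2|i2] := ltnP i p.+1.
    have -> : i = p by lia.
    rewrite nth_take // subnn addn0.
    by have := le p; move/spreadP/(_ p ltac:(lia)): ss; lia.
  have -> : p.+1 + (i - p.+1) = i by lia.
  have -> : p.+1 + (i.+1 - p.+1) = i.+1 by lia.
  by move/spreadP: ss; apply; lia.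
split=> //; set x := nth 0 s p; set y := nth 0 s' p.
have e1 : take p s' ++ drop p s = take p s' ++ x :: drop p.+1 s.
  by rewrite (drop_nth 0).
have e2 : take p.+1 s' ++ drop p.+1 s = take p s' ++ y :: drop p.+1 s.
  by rewrite (take_nth 0) // cat_rcons.
have xn : x < n by apply: (allP bs); apply: mem_nth.
have yx : y <= x := le p.
have [exy|nxy] := eqVneq x y; first by rewrite e2 -exy -e1.
have yn : y < n by lia.
set w := take p s' ++ drop p.+1 s.
have w1 : mon n (take p s' ++ drop p s) = (mon n w + U_(Ordinal xn))%MM.
  rewrite e1 -mon_ord -mon_cat; apply: mon_perm.
  by rewrite -cat1s perm_catCA perm_sym perm_catC.
have w2 : mon n (take p.+1 s' ++ drop p.+1 s) = (mon n w + U_(Ordinal yn))%MM.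
  rewrite e2 -mon_ord -mon_cat; apply: mon_perm.
  by rewrite -cat1s perm_catCA perm_sym perm_catC.
have bp : bounded (take p s' ++ drop p s).
  apply/allP => c; rewrite mem_cat => /orP[/mem_take|/mem_drop/(allP bs)//].
  by move: c; apply/allP; apply: (cwle_bounded (s' := s)).
have bp' : bounded (take p.+1 s' ++ drop p.+1 s).
  apply/allP => c; rewrite mem_cat => /orP[/mem_take|/mem_drop/(allP bs)//].
  by move: c; apply/allP; apply: (cwle_bounded (s' := s)).
have tsp : tspread t (mon n (take p s' ++ drop p s)).
  by rewrite /tspread monK // (spread_sorted sp).
have := stI _ (Ordinal yn) (Ordinal xn) tsp Ip.
rewrite {1 2 3}w1 addmK -w2 mnmDE mnm1E eqxx addn1 /tspread monK //; last first.
  exact: spread_sorted sp'.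
by apply=> //=; lia.
Qed.

End MonomialIdeals.
Arguments gens_ideal : clear implicits.

(** [G] consists of the index sequences of the minimal generators. For a spread [s'] below one of
    them, the shortest prefix of [s'] whose monomial lies in [I] turns out to be a minimal
    generator. *)
Lemma strongly_stable_gens (K : fieldType) n t (I : set {mpoly K[n]}) :
  tspread_strongly_stable t I ->
  exists G, [/\ stable_gens t G, forall s, G s -> all (fun i => i < n) s
    & I = gens_ideal K n G].
Proof.
move=> stI; have [[M Mt IM] _] := stI.
have idI : is_ideal I by rewrite IM; apply: ideal_gen_is_ideal.
have mint u : min_gens I u -> spread t (indices u).
  move=> [Iu umin]; move: (Iu); rewrite IM monomial_idealX => -[v Mv vu].
  rewrite -(umin v) //; first exact: Mt.
  by rewrite IM; apply/monomial_idealX; exists v => //; apply: lepm_refl.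
exists (@indices n @` min_gens I); split; last first.
- rewrite /gens_ideal image_comp (_ : _ \o _ = id) ?image_id; last first.
    by apply/funext => m; apply: indicesK.
  rewrite monomial_idealE; apply/seteqP; split=> f.
    rewrite {1}IM monomial_idealE => If m /If[u Mu um].
    have [|v mv vu] := @min_gens_exist _ _ I u; last first.
      by exists v => //; apply: lepm_trans um.
    by rewrite IM; apply/monomial_idealX; exists u => //; apply: lepm_refl.
  move=> Mf; rewrite (mpolyE f) big_seq; apply: (is_ideal_sum _ idI) => m.
  by move=> /Mf[u [Iu _] um]; apply/(is_idealZ _ idI)/(monomial_ideal_up idI Iu um).
- by move=> _ [u _ <-]; apply: indices_bounded.
split=> [_ [u /mint ? <-] //|_ s' [u [Iu _] <-] le st|_ k [u [Iu umin] <-]]; last first.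
  move=> [v [Iv vmin] e]; rewrite -e -(umin v) //.
  rewrite -(indicesK u) -(indicesK v) e; apply: subseq_mon; exact: take_subseq.
have bs' : all (fun i => i < n) s' := cwle_bounded le (indices_bounded _).
pose P k := `[< I 'X_[mon n (take k s')]%R >].
have Pex : exists k, P k.
  exists (size s'); apply/asboolP; rewrite take_size.
  have [v [Iv vmin] vu] := min_gens_exist Iu.
  have bv := indices_bounded v.
  have sv : spread t (indices v) by apply: mint.
  have sub : subseq (indices v) (indices u).
    by apply: (mon_subseq bv (indices_sorted _) (indices_sorted _)); rewrite !indicesK.
  have le2 : cwle (take (size (indices v)) s') (indices v).
    apply: (cwle_trans (cwle_take _ le)).
    exact: subseq_cwle (indices_sorted _) sub.
  apply: (monomial_ideal_up (m := mon n (take (size (indices v)) s')) idI).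
    apply: (strongly_stable_cwle stI _ sv _ le2) => //; first exact: spread_take.
    by rewrite indicesK.
  by apply: subseq_mon; apply: take_subseq.
have [k /asboolP Ik kmin] := ex_minnP Pex.
have bk : all (fun i => i < n) (take k s').
  by apply/allP => c /mem_take/(allP bs').
have sk : sorted leq (take k s') by apply/(spread_sorted (t := t))/spread_take.
exists k; exists (mon n (take k s')); last exact: monK.
split=> // u' Iu' le'; apply/mnmP => i; apply/eqP; rewrite eqn_leq.
rewrite (mnm_lepP le') /=.
have [v mv vu'] := min_gens_exist Iu'; have [Iv _] := mv.
apply: leq_trans (mnm_lepP vu' i).
suff -> : mon n (take k s') = v by [].
have sub : subseq (indices v) (take k s').
  apply: (mon_subseq (indices_bounded v) (indices_sorted _)) => //.
  by rewrite indicesK; apply: lepm_trans vu' le'.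
have := size_subseq sub; rewrite size_take_min leq_min => /andP[vk vs'].
(* The prefix of [s'] as long as [indices v] lies below [v], hence in [I]. As [k] is the least
   possible length, the divisor [v] has full length and equals the prefix. *)
have le3 := subseq_cwle sk sub; rewrite -take_min (minn_idPl vk) in le3.
have ksz : k <= size (indices v).
  apply: kmin; apply/asboolP.
  apply: (strongly_stable_cwle stI (indices_bounded v) (mint _ mv) _ le3).
    exact: spread_take.
  by rewrite indicesK.
rewrite -(indicesK v); congr (mon n _); apply/esym/eqP.
rewrite -(size_subseq_leqif sub) eqn_leq (size_subseq sub).
by rewrite size_take_min; apply: leq_trans (geq_minl _ _) ksz.
Qed.

(** * Operations on ideals read off on generator sequences *)

Lemma map_gens_gens_ideal (K : fieldType) n N t (phi : seq nat -> seq nat) G :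
  stable_gens t G -> (forall s, G s -> all (fun i => i < n) s) ->
  (forall s, G s -> sorted leq (phi s)) ->
  (forall s, G s -> all (fun i => i < N) (phi s)) ->
  map_gens phi N (gens_ideal K n G) = gens_ideal K N (phi @` G).
Proof.
move=> GG Gb ps pb; rewrite /map_gens (min_gens_gens_ideal _ GG) //.
have [Gt _ _] := GG.
congr monomial_ideal; apply/seteqP; split=> m /=.
  move=> [_ [s Gs <-]]; rewrite (monK (spread_sorted (Gt _ Gs)) (Gb _ Gs)) => e.
  by exists (phi s); [exists s|rewrite -e indicesK].
move=> [_ [s Gs <-] <-]; exists (mon n s); first by exists s.
by rewrite !monK ?ps ?pb ?Gb // (spread_sorted (Gt _ Gs)).
Qed.

Lemma in_vars_gens_ideal (K : fieldType) n N t G :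
  stable_gens t G -> (forall s, G s -> all (fun i => i < n) s) ->
  (forall s, G s -> all (fun i => i < N) s) ->
  in_vars N (gens_ideal K n G) = gens_ideal K N G.
Proof.
move=> GG Gb GN; rewrite /in_vars (map_gens_gens_ideal _ GG) ?image_id //.
by have [Gt _ _] := GG => s /Gt/spread_sorted.
Qed.

Lemma tau_gens_ideal (K : fieldType) N t G :
  stable_gens t G -> (forall s, G s -> all (fun i => i < N) s) ->
  tau_ideal t (gens_ideal K N G) = gens_ideal K N (iter t tau_seq @` G).
Proof.
elim: t G => [|t IH] G GG Gb; first by rewrite image_id.
have GG' := stable_gens_tau GG.
have -> : iter t.+1 tau_seq = iter t tau_seq \o tau_seq.
  by apply/funext => s; rewrite iterSr.
rewrite /tau_ideal iterSr (map_gens_gens_ideal _ GG) -?image_comp //.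
- by apply: IH => // _ [s /Gb/bounded_tau ? <-].
- move=> s Gs; have [st _ _] := GG'.
  by apply/(spread_sorted (t := t))/st; exists s.
- by move=> s /Gb/bounded_tau.
Qed.

Lemma sigma_gens_ideal (K : fieldType) N t G :
  stable_gens 0 G -> (forall s, G s -> all (fun i => i < N) (iter t sigma_seq s)) ->
  sigma_ideal t (gens_ideal K N G) = gens_ideal K N (iter t sigma_seq @` G).
Proof.
move=> GG; elim: t => [|t IH] Gb; first by rewrite image_id.
have Gb' s : G s -> all (fun i => i < N) (iter t sigma_seq s).
  by move=> /Gb/bounded_sigma.
have GG' := stable_gens_iter_sigma t GG.
rewrite /sigma_ideal iterS -/(sigma_ideal _ _) IH //.
rewrite (map_gens_gens_ideal _ GG') ?image_comp //.
- by move=> _ [s /Gb' ? <-].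
- move=> _ [s Gs <-]; have [st _ _] := GG'.
  by apply/(spread_sorted (t := t.+1))/spread_sigma/st; exists s.
- by move=> _ [s /Gb ? <-].
Qed.

(** * Boundedness of the degrees of the generators *)

Lemma sorted_cat_nseq p a k :
  sorted leq p -> all (fun i => i <= k) p -> sorted leq (p ++ nseq a k).
Proof.
rewrite !(sorted_pairwise leq_trans) pairwise_cat => -> pk.
rewrite -(sorted_pairwise leq_trans); apply/and3P; split=> //.
  by apply/allrelP => x y /(allP pk) xk /nseqP[-> _].
by case: a => //= a; elim: a => //= a ->; rewrite leqnn.
Qed.

(* Finite generation by induction on the number k of variables: if p is the part
   of s in the first k variables and x is the last of these, then p x^a has a
   prefix in G, which is longer than p; so the size of p is bounded, and the
   exponent of the new variable is determined by p. *)
Lemma stable_gens_size_bound G k : stable_gens 0 G ->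
  exists D, forall s, G s -> all (fun i => i < k) s -> size s <= D.
Proof.
move=> [Gt Gle Gp]; elim: k => [|k [D GD]].
  by exists 0 => -[|x s].
have finp m : exists B, forall p, size p <= m -> all (fun i => i < k) p ->
    forall a, G (p ++ nseq a k) -> a <= B.
  (* A fixed prefix [p0] is carried along, so that the induction on [m] can move the first entry of
     [p] into it. *)
  suff H p0 : exists B, forall p, size p <= m -> all (fun i => i < k) p ->
    forall a, G (p0 ++ p ++ nseq a k) -> a <= B by apply: (H [::]).
  (* For a given [p] at most one exponent occurs, since otherwise one generator would be a proper
     prefix of another. *)
  have base p : exists B, forall a, G (p ++ nseq a k) -> a <= B.
    have [[a Ga]|nG] := pselect (exists a, G (p ++ nseq a k)); last first.
      by exists 0 => a Ga; case: nG; exists a.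
    exists a => b Gb; rewrite leqNgt; apply/negP => ab.
    have e : take (size p + a) (p ++ nseq b k) = p ++ nseq a k.
      by rewrite take_cat ltnNge leq_addr /= addKn take_nseq // ltnW.
    have := Gp _ (size p + a) Gb; rewrite e => /(_ Ga)/(congr1 size).
    by rewrite !size_cat !size_nseq; lia.
  elim: m p0 => [|m IH] p0.
    by have [B HB] := base p0; exists B => -[|//] _ _ a /HB.
  have [B HB] := base p0.
  have /choice[F HF] (i : 'I_k) := IH (rcons p0 i).
  exists (maxn B (\max_i F i)) => -[_ _ a /HB|i p]; first by lia.
  move=> /= pm /andP[ik pk] a; rewrite -cat_rcons => Ga.
  apply: leq_trans (HF (Ordinal ik) p pm pk a Ga) _.
  exact: leq_trans (@leq_bigmax _ F (Ordinal ik)) (leq_maxr _ _).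
have [B HB] := finp D; exists (D + B) => s Gs sk.
have ss := spread_sorted (Gt _ Gs).
have [p [a [es pk]]] : exists p a, s = p ++ nseq a k /\ all (fun i => i < k) p.
  exists [seq i <- s | i < k], (count_mem k s); split; last exact: filter_all.
  apply: (sorted_eq leq_trans anti_leq) => //.
    apply: sorted_cat_nseq; first exact: sorted_filter leq_trans _ _ ss.
    by apply/allP => i; rewrite mem_filter => /andP[/ltnW].
  apply/permP => P; rewrite count_cat count_nseq count_filter.
  elim: (s) sk => [|x r IH] /=; first by rewrite muln0.
  move=> /andP[xk /IH ->].
  by case: (ltngtP x k) xk => [xk|xk|->] xk'; rewrite ?andbT ?andbF /= ?add0n ?mulnS; lia.
have [a0|a0] := posnP a.
  by rewrite es a0 cats0 in Gs *; have := GD _ Gs pk; lia.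
suff pD : size p <= D.
  rewrite es in Gs; have := HB p pD pk a Gs.
  by rewrite es size_cat size_nseq; lia.
case: k => [|k] in es pk GD {finp HB sk} *; first by case: p pk es.
(* Lower each [k.+1] in [s] to [k]; some prefix of the result is in [G]. If it had length at most
   [size p] it would be a proper prefix of [s]; so it is longer than [p], and [D] bounds its
   size. *)
have [] := Gle s (p ++ nseq a k) Gs.
- rewrite es; split=> [|i]; first by rewrite !size_cat !size_nseq.
  by rewrite !nth_cat !nth_nseq; case: ifP => // _; case: ifP.
- rewrite /spread (eq_sorted (e' := leq)) => [|i j]; last by rewrite addn0.
  apply: sorted_cat_nseq => //.
  by move: ss; rewrite es => /cat_sorted2[].
move=> j Gj; have [jp|pj] := leqP j (size p).
  have e : take j (p ++ nseq a k) = take j s by rewrite es !takel_cat.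
  rewrite e in Gj; have := congr1 size (Gp _ _ Gs Gj).
  by rewrite {2}es size_cat size_nseq size_take_min; lia.
have := GD _ Gj; rewrite size_take_min size_cat size_nseq => H.
apply: leq_trans (H _); first by lia.
apply/allP => c /mem_take; rewrite mem_cat => /orP[/(allP pk)//|/nseqP[-> _]].
exact: ltnSn.
Qed.

(** * Generic coordinates *)

Section Generic.
Local Open Scope ring_scope.

Variable K : fieldType.
Hypothesis charK : [pchar K] =i pred0.

(** In characteristic zero the first [size p] natural numbers are distinct scalars, one more than
    the degree allows as roots. *)
Lemma poly_nonroot (p : {poly K}) : p != 0 -> exists c, p.[c] != 0.
Proof.
move=> p0; apply: contrapT => noc.
have := @max_poly_roots _ p [seq i%:R | i <- iota 0 (size p)] p0.
rewrite size_map size_iota ltnn => h.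
suff : false by []; apply: h.
  apply/allP => _ /mapP[i _ ->]; apply/negPn/negP => r.
  by apply: noc; exists i%:R.
rewrite map_inj_in_uniq ?iota_uniq // => i j _ _ /eqP.
wlog ij : i j / (i <= j)%N.
  by move=> H; case: (leqP i j) => [/H//|/ltnW/H h']; rewrite eq_sym => /h'.
have /pcharf0P char0 := charK.
rewrite eq_sym -subr_eq0 -natrB // char0 subn_eq0 => ji.
by apply/eqP; rewrite eqn_leq ij.
Qed.

(* Restrict both polynomials to the line through x and y. *)
Lemma common_nonzero n (p q : {mpoly K[n]}) x y :
  p.@[x] != 0 -> q.@[y] != 0 -> exists z, (p * q).@[z] != 0.
Proof.
move=> px qy.
pose h i : {poly K} := (x i)%:P + 'X * (y i - x i)%:P.
pose L (r : {mpoly K[n]}) := mmap (@polyC K) h r.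
have LE r c : (L r).[c] = r.@[fun i => x i + c * (y i - x i)].
  rewrite mevalE /L /mmap horner_sum; apply: eq_bigr => m _.
  rewrite hornerM hornerC; congr (_ * _).
  rewrite /mmap1 horner_prod; apply: eq_bigr => i _.
  by rewrite horner_exp /h !hornerE.
have [] := @poly_nonroot (L p * L q).
  rewrite mulf_neq0 //; apply/eqP => L0.
    move/eqP: px; apply; have := LE p 0; rewrite L0 horner0 => ->.
    by apply: meval_eq => i; rewrite mul0r addr0.
  move/eqP: qy; apply; have := LE q 1; rewrite L0 horner0 => ->.
  by apply: meval_eq => i; rewrite mul1r addrC subrK.
by move=> c; rewrite hornerM !LE -mevalM; exists (fun i => x i + c * (y i - x i)).
Qed.

Variable n : nat.

Lemma mxvec_surj (x : 'I_(n * n) -> K) : exists g : 'M[K]_n, mxvec g 0 = x.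
Proof.
by exists (vec_mx (\row_i x i)); apply/funext => i; rewrite vec_mxK mxE.
Qed.

(* Invertibility of all these matrices says that the maximal minors of the first
   k rows of g do not vanish, for all k. *)
Definition mixed_mx (R : nzRingType) (g : 'M[R]_n) (a : {ffun 'I_n -> 'I_n})
    (k : 'I_n.+1) : 'M[R]_n :=
  \matrix_(i, j) if (j < k)%N then g i (a j) else (i == j)%:R.

Definition inj_below (a : {ffun 'I_n -> 'I_n}) (k : 'I_n.+1) : bool :=
  [forall i : 'I_n, forall j : 'I_n,
     [&& (i < k)%N, (j < k)%N & a i == a j] ==> (i == j)].

Definition generic_mx (g : 'M[K]_n) : Prop :=
  forall a k, inj_below a k -> mixed_mx g a k \in unitmx.

(** Take the product of the determinants of all the mixed matrices. Each factor is nonzero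
    somewhere, hence so is the product by [common_nonzero]. The identity selection with [k = n] has
    [g] itself as its mixed matrix. *)
Lemma generic_open : exists p : {mpoly K[n * n]},
  (exists x, p.@[x] != 0) /\
  forall g : 'M[K]_n, p.@[mxvec g 0] != 0 -> g \in unitmx /\ generic_mx g.
Proof.
pose X : 'M[{mpoly K[n * n]}]_n := \matrix_(i, j) 'X_(mxvec_index i j).
have XE g a k : (\det (mixed_mx X a k)).@[mxvec g 0] = \det (mixed_mx g a k).
  rewrite -det_map_mx; congr determinant; apply/matrixP => i j; rewrite !mxE.
  case: ifP => _; first by rewrite /= mevalXU mxvecE.
  by rewrite rmorph_nat.
pose p (ak : {ffun 'I_n -> 'I_n} * 'I_n.+1) := \det (mixed_mx X ak.1 ak.2).
have exp ak : inj_below ak.1 ak.2 -> exists x, (p ak).@[x] != 0.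
  case: ak => a k /= inj.
  (* This partial permutation matrix makes the mixed matrix the identity. *)
  pose g : 'M[K]_n := \matrix_(i, c) ((i < k)%N && (c == a i))%:R.
  exists (mxvec g 0); rewrite XE (_ : mixed_mx g a k = 1%:M) ?det1 ?oner_neq0 //.
  apply/matrixP => i j; rewrite !mxE; case: ifP => // jk.
  have [->|ij] := eqVneq i j; first by rewrite jk eqxx.
  case: (ltnP i k) => //= ik; case: eqP => // e.
  have /forallP/(_ i)/forallP/(_ j) := inj.
  by rewrite ik jk e eqxx (negPf ij).
exists (\prod_(ak | inj_below ak.1 ak.2) p ak); split.
  apply: (big_ind (fun q : {mpoly K[n * n]} => exists x, q.@[x] != 0)) => //.
    by exists (fun=> 0); rewrite meval1 oner_neq0.
  by move=> q r [x qx] [y ry]; apply: common_nonzero qx ry.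
move=> g; rewrite rmorph_prod /= => /prodf_neq0 pg.
have gg : generic_mx g.
  by move=> a k inj; rewrite unitmxE unitfE -XE; apply: (pg (a, k)).
split=> //; have := gg [ffun i => i] ord_max.
rewrite (_ : mixed_mx _ _ _ = g); last first.
  by apply/matrixP => i j; rewrite mxE ffunE ltn_ord.
apply; apply/forallP => i; apply/forallP => j.
by apply/implyP => /and3P[_ _]; rewrite !ffunE.
Qed.

Definition is_subspace (V : set {mpoly K[n]}) : Prop :=
  [/\ V 0, (forall f g, V f -> V g -> V (f + g))
    & (forall c f, V f -> V (c *: f))].

Lemma is_subspace_sum V (I : Type) (r : seq I) (P : pred I) (F : I -> {mpoly K[n]}) :
  is_subspace V -> (forall i, P i -> V (F i)) -> V (\sum_(i <- r | P i) F i).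
Proof. by move=> [V0 VD _] VF; apply: big_ind. Qed.

(** The image of the variable of index [c]. A [nat] index allows products over sequences; for [c] at
    least [n] the value is [1]. *)
Definition lform (g : 'M[K]_n) (c : nat) : {mpoly K[n]} :=
  lin_subst g 'X_[mon n [:: c]].

Lemma lformE g (j : 'I_n) : lform g j = \sum_(i < n) g i j *: 'X_i.
Proof.
by rewrite /lform mon_ord /lin_subst comp_mpolyXU -tnth_nth tnth_mktuple.
Qed.

Lemma lin_subst_mon g s : lin_subst g 'X_[mon n s] = \prod_(c <- s) lform g c.
Proof.
elim: s => [|c s IH]; first by rewrite mon_nil mpolyX0 big_nil /lin_subst rmorph1.
by rewrite big_cons -IH -cat1s mon_cat mpolyXD /lin_subst rmorphM.
Qed.

(** The columns of a mixed matrix with [k = size A] are the coefficients of the forms indexed by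
    [A], followed by those of the variables from [k] on. Inverting it writes every variable in terms
    of elements of [V]. *)
Lemma generic_span g (A : seq nat) (V : set {mpoly K[n]}) : generic_mx g ->
  uniq A -> all (fun i => i < n)%N A -> is_subspace V ->
  (forall c, c \in A -> V (lform g c)) ->
  (forall j : 'I_n, (size A <= j)%N -> V 'X_j) -> forall i : 'I_n, V 'X_i.
Proof.
move=> gg uA bA VV VA VX i.
have An : (size A <= n)%N.
  have := @uniq_leq_size _ A (iota 0 n) uA; rewrite size_iota; apply.
  by move=> c /(allP bA); rewrite mem_iota.
pose k : 'I_n.+1 := Ordinal (An : (size A < n.+1)%N).
(* The values from [k] on, where the default [i] is used, are never read: those columns are unit
   columns. *)
pose a : {ffun 'I_n -> 'I_n} := [ffun j : 'I_n => insubd i (nth 0%N A j)].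
have aE (j : 'I_n) : (j < k)%N -> a j = nth 0%N A j :> nat.
  by move=> jk; rewrite ffunE val_insubd (allP bA) ?mem_nth.
have /gg Bu : inj_below a k.
  apply/forallP => i1; apply/forallP => i2; apply/implyP => /and3P[h1 h2 /eqP].
  by move=> /(congr1 val); rewrite /= !aE // => /eqP; rewrite nth_uniq.
set B := mixed_mx g a k in Bu.
pose y := invmx B *m delta_mx i (0 : 'I_1).
have By : B *m y = delta_mx i 0 by rewrite mulKVmx.
pose F (j : 'I_n) : {mpoly K[n]} := if (j < k)%N then lform g (a j) else 'X_j.
have FE j : F j = \sum_l B l j *: 'X_l.
  rewrite /F; case: ifP => jk; first rewrite lformE.
    by apply: eq_bigr => l _; rewrite mxE jk.
  rewrite (bigD1 j) //= big1 ?addr0 => [|l lj]; rewrite mxE jk ?eqxx ?scale1r //.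
  by rewrite (negPf lj) scale0r.
have -> : 'X_i = \sum_j y j 0 *: F j.
  under eq_bigr => j _ do rewrite FE scaler_sumr.
  have BE l : \sum_j y j 0 *: (B l j *: 'X_l) = (l == i)%:R *: 'X_l :> {mpoly K[n]}.
    under eq_bigr => j _ do rewrite scalerA mulrC.
    rewrite -scaler_suml; congr (_ *: _).
    by have /matrixP/(_ l 0) := By; rewrite !mxE eqxx andbT.
  rewrite exchange_big /=; under eq_bigr => l _ do rewrite BE.
  rewrite (bigD1 i) //= eqxx scale1r big1 ?addr0 // => l /negPf ->.
  by rewrite scale0r.
have [_ _ VZ] := VV.
apply: is_subspace_sum => // j _; apply: (VZ); rewrite /F; case: ifP => jk.
  by apply: VA; rewrite aE // mem_nth.
by apply: VX; rewrite leqNgt -/(nat_of_ord k) jk.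
Qed.

End Generic.

(** * Leading monomials in generic coordinates *)

Section RevLex.
Local Open Scope ring_scope.

Variable n : nat.
Implicit Types u v w : 'X_{1..n}.

Lemma revlex_irr u : revlex_lt u u = false.
Proof.
by rewrite /revlex_lt ltnn eqxx /=; apply/existsP => -[i]; rewrite ltnn.
Qed.

Lemma revlex_trans v u w : revlex_lt u v -> revlex_lt v w -> revlex_lt u w.
Proof.
rewrite /revlex_lt => /orP[h1|/andP[/eqP e1 /existsP[i /andP[i1 /forallP i2]]]].
  by case/orP=> [h2|/andP[/eqP e2 _]]; apply/orP; left; [exact: ltn_trans h1 h2|lia].
case/orP=> [h2|/andP[/eqP e2 /existsP[j /andP[j1 /forallP j2]]]].
  by apply/orP; left; lia.
apply/orP; right; rewrite e1 e2 eqxx /=; apply/existsP.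
have {}i2 (l : 'I_n) : (i < l)%N -> u l = v l by move=> il; apply/eqP/(implyP (i2 l)).
have {}j2 (l : 'I_n) : (j < l)%N -> v l = w l by move=> il; apply/eqP/(implyP (j2 l)).
case: (ltngtP i j) => [ij|ji|/val_inj e].
- exists j; rewrite i2 // j1; apply/forallP => l; apply/implyP => jl.
  by rewrite i2 ?j2 //; apply: ltn_trans jl.
- exists i; rewrite -j2 // i1; apply/forallP => l; apply/implyP => il.
  by rewrite i2 ?j2 //; apply: ltn_trans il.
- subst j; exists i; rewrite (ltn_trans j1 i1); apply/forallP => l.
  by apply/implyP => il; rewrite i2 ?j2.
Qed.

Lemma revlex_add w u v : revlex_lt u v -> revlex_lt (u + w)%MM (v + w)%MM.
Proof.
rewrite /revlex_lt !mdegD ltn_add2r eqn_add2r => /orP[->//|/andP[-> /=]].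
move=> /existsP[i /andP[i1 /forallP i2]]; apply/orP; right; apply/existsP.
exists i; rewrite !mnmDE ltn_add2r i1; apply/forallP => j; apply/implyP => ij.
by rewrite !mnmDE eqn_add2r (implyP (i2 j)).
Qed.

(** At the largest index occurring in [u], which is past [k], [u] has the larger exponent, and
    beyond it both vanish. So discarding the variables past [k] never discards a larger monomial of
    the same degree. *)
Lemma revlex_last (k : nat) u v (j : 'I_n) : mdeg u = mdeg v ->
  (forall i : 'I_n, (k < i)%N -> v i = 0%N) -> (k < j)%N -> (0 < u j)%N ->
  revlex_lt u v.
Proof.
move=> e v0 kj uj; rewrite /revlex_lt e eqxx ltnn /=; apply/existsP.
case: (@arg_maxnP _ j (fun i : 'I_n => 0 < u i)%N val uj) => i ui imax.
have ki : (k < i)%N by apply: leq_trans kj (imax _ uj).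
exists i; rewrite v0 // ui; apply/forallP => l; apply/implyP => il.
rewrite v0 ?(ltn_trans ki il) //; apply: contraT; rewrite -lt0n => /imax /=.
by lia.
Qed.

End RevLex.

Section Leading.
Local Open Scope ring_scope.

Variables (K : fieldType) (n : nat) (g : 'M[K]_n).
Hypothesis gg : generic_mx g.
Implicit Types (m : 'X_{1..n}) (V : set {mpoly K[n]}) (p f h : {mpoly K[n]}).
Implicit Types s : seq nat.

Local Notation bounded := (all (fun i => i < n)%N).
Local Notation phi s := (lin_subst g 'X_[mon n s]).

Lemma mcoeff_mulXU0 p (j : 'I_n) m : m j = 0%N -> ('X_j * p)@_m = 0.
Proof.
move=> mj; apply: memN_msupp_eq0; rewrite mulrC (perm_mem (msuppMX _ _)).
apply/mapP => -[m' _ e]; move: mj.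
by rewrite e mnmDE mnm1E eqxx addnC addn1.
Qed.

Lemma mcoeff_mulXU p (j : 'I_n) m : ('X_j * p)@_(m + U_(j))%MM = p@_m.
Proof. by rewrite mulrC addmC mcoeffMX. Qed.

Lemma lin_subst_homog m : lin_subst g 'X_[m] \is (mdeg m).-homog.
Proof.
rewrite -(indicesK m) mdeg_mon ?indices_bounded // lin_subst_mon.
elim: indices (indices_bounded m) => [|c s IH] /=; first by rewrite big_nil dhomog1.
move=> /andP[cn /IH hs]; rewrite big_cons -add1n; apply: dhomogM => //.
rewrite (lformE g (Ordinal cn)); apply: rpred_sum => i _.
by apply: rpredZ; rewrite dhomogX /= mdeg1.
Qed.

(* Polynomials in the ideal generated by the x_j with j > k. *)
Definition vanish_below (k : nat) : set {mpoly K[n]} :=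
  [set p | forall m, (forall j : 'I_n, (k < j)%N -> m j = 0%N) -> p@_m = 0].

Lemma vanish_below_subspace k : is_subspace (vanish_below k).
Proof.
split=> [m _|p q hp hq m mk|c p hp m mk]; first exact: mcoeff0.
  by rewrite mcoeffD hp ?hq ?addr0.
by rewrite mcoeffZ hp ?mulr0.
Qed.

(** For fixed [p] the multipliers [f] form a subspace, to which [generic_span] can be applied. *)
Definition reducible V d k p : set {mpoly K[n]} :=
  [set f | exists h, [/\ V h, h \is d.-homog & vanish_below k (f * p - h)]].

Lemma reducible_subspace V d k p : is_subspace V -> is_subspace (reducible V d k p).
Proof.
move=> [V0 VD VZ]; have [D0 DD DZ] := vanish_below_subspace k.
split=> [|f1 f2 [h1 [? ? ?]] [h2 [? ? ?]]|c f [h [? ? ?]]].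
- by exists 0; split; rewrite ?rpred0 // mul0r subr0.
- exists (h1 + h2); split; [exact: VD|exact: rpredD|].
  by rewrite mulrDl opprD addrACA; apply: DD.
- exists (c *: h); split; [exact: VZ|exact: rpredZ|].
  by rewrite -scalerAl -scalerBr; apply: DZ.
Qed.

(** Induction on the sum of [s']. Indices start at [0], so the variables up to [k] number [k.+1],
    and as many linear forms are required. *)
Lemma reducible_var t V s x (k := (x - size s * t)%N) :
  spread t (rcons s x) -> bounded (rcons s x) -> is_subspace V ->
  (forall s', spread t s' -> cwle s' (rcons s x) -> V (phi s')) ->
  forall s', spread t s' -> cwle s' s -> forall i : 'I_n,
    reducible V (size s).+1 k (phi s') 'X_i.
Proof.
move=> st bs VV Vphi s'; have [N] := ubnP (sumn s').
elim: N s' => // N IH s' sN st' le i.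
have sz : size s' = size s by case: le.
have xst : (size s * t <= x)%N.
  have := spread_gap st (leq0n (size s)); rewrite size_rcons => /(_ (ltnSn _)).
  by rewrite nth_rcons_size; lia.
have bs' : bounded s'.
  by move: bs; rewrite all_rcons => /andP[_]; apply: cwle_bounded le.
have xn : (x < n)%N by move: bs; rewrite all_rcons => /andP[].
pose A0 := [seq c <- iota 0 x.+1 | c \notin blocks t s'].
(* Of the [x.+1] indices up to [x], at most [size s * t] lie in the blocks of [s']. *)
have A0k : (k < size A0)%N.
  have := count_predC (mem (blocks t s')) (iota 0 x.+1); rewrite size_iota.
  rewrite -[count (predC _) _]size_filter -/A0.
  suff : (count (mem (blocks t s')) (iota 0 x.+1) <= size s * t)%N.
    by rewrite -[size (filter _ _)]/(size A0) /k; lia.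
  rewrite -sz -size_blocks -size_filter; apply: uniq_leq_size.
    by rewrite filter_uniq // iota_uniq.
  by move=> c; rewrite mem_filter => /andP[].
have Ax c : c \in A0 -> (c <= x)%N /\ c \notin blocks t s'.
  by rewrite mem_filter mem_iota => /andP[-> /= ?]; split; lia.
have Ak : size (take k.+1 A0) = k.+1 by rewrite size_takel.
have RR := @reducible_subspace V (size s).+1 k (phi s') VV.
have [V0 _ _] := VV.
apply: (generic_span gg (A := take k.+1 A0) _ _ RR).
- by rewrite take_uniq // filter_uniq // iota_uniq.
- by apply/allP => c /mem_take/Ax[]; lia.
- move=> c /mem_take/Ax[cx cb].
  have phic s1 c1 : lform g c1 * phi s1 = phi (c1 :: s1).
    by rewrite -cat1s mon_cat mpolyXD /lin_subst rmorphM.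
  case: (swap_smaller st' cb) => [src|[y [w [pe sw lew sm]]]].
    exists (phi (rcons s' c)); split.
    - apply: Vphi => //; case: le => e l; split=> [|j].
        by rewrite !size_rcons e.
      by rewrite !nth_rcons e; case: ifP => // _; case: ifP.
    - have := lin_subst_homog (mon n (rcons s' c)).
      rewrite mdeg_mon ?size_rcons ?sz // all_rcons bs' andbT; lia.
    rewrite phic (_ : mon n (c :: s') = mon n (rcons s' c)) ?subrr; last apply: mon_perm.
      by have [] := vanish_below_subspace k.
    by rewrite perm_sym perm_rcons.
  have yn : (y < n)%N.
    have : y \in c :: s' by rewrite -(perm_mem pe) mem_head.
    by rewrite inE => /orP[/eqP->|/(allP bs')//]; lia.
  (* The induction hypothesis handles every variable times [phi w], hence also the linear form
     [lform g y]. *)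
  have Ry : reducible V (size s).+1 k (phi w) (lform g y).
    have R' := @reducible_subspace V (size s).+1 k (phi w) VV.
    rewrite (lformE g (Ordinal yn)); apply: (is_subspace_sum _ R') => l _.
    have [_ _ RZ'] := R'; apply: (RZ'); apply: IH => //; first by lia.
    exact: cwle_trans le.
  move: Ry; rewrite /reducible /= phic => -[h [Vh hh Dh]]; exists h; split=> //.
  by rewrite phic -(mon_perm n pe).
(* Multiples of a variable past [k] are congruent to [0]. *)
rewrite Ak => j kj; exists 0; split; rewrite ?rpred0 // subr0 => m mk.
by apply: mcoeff_mulXU0; apply: mk.
Qed.

(** An arbitrary subspace [V] is allowed because the induction on [s] applies the statement to
    another one: the [f] whose product with each variable is congruent, modulo the variables past
    [k], to a form in [V]. *)
Lemma leading_monomial t s : spread t s -> bounded s -> forall V, is_subspace V ->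
  (forall s', spread t s' -> cwle s' s -> V (phi s')) ->
  exists f, [/\ V f, f \is (size s).-homog
    & initial_monomial f (mon n (iter t tau_seq s))].
Proof.
elim/last_ind: s => [|s x IH] st bs V VV Vphi.
  exists 1; split; [|exact: dhomog1|].
    by have := Vphi [::] isT (cwle_refl _); rewrite mon_nil mpolyX0 /lin_subst rmorph1.
  have -> : iter t tau_seq [::] = [::] by elim: t {st Vphi} => //= t ->.
  rewrite mon_nil; split=> [|u]; first by rewrite msupp1 mem_head.
  by rewrite msupp1 inE => ->.
pose k := (x - size s * t)%N.
have xn : (x < n)%N by move: bs; rewrite all_rcons => /andP[].
have bs' : bounded s by move: bs; rewrite all_rcons => /andP[].
have kn : (k < n)%N by rewrite /k; lia.
have st' : spread t s by move: st; rewrite -cats1 => /cat_sorted2[].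
pose V' : set {mpoly K[n]} :=
  [set f | forall i : 'I_n, reducible V (size s).+1 k f 'X_i].
have VV' : is_subspace V'.
  have [V0 VD VZ] := VV; have [D0 DD DZ] := vanish_below_subspace k.
  split=> [i|f1 f2 H1 H2 i|c f H i].
  - by exists 0; split; rewrite ?rpred0 // mulr0 subr0.
  - have [h1 [? ? ?]] := H1 i; have [h2 [? ? ?]] := H2 i.
    exists (h1 + h2); split; [exact: VD|exact: rpredD|].
    by rewrite mulrDr opprD addrACA; apply: DD.
  - have [h [? ? ?]] := H i.
    exists (c *: h); split; [exact: VZ|exact: rpredZ|].
    by rewrite -scalerAr -scalerBr; apply: DZ.
have [f [Vf fh [f1 f2]]] := IH st' bs' V' VV' (reducible_var st bs VV Vphi).
have [h [Vh hh Dh]] := Vf (Ordinal kn).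
exists h; rewrite size_rcons; split=> //.
set v := mon n (iter t tau_seq s) in f1 f2.
have -> : mon n (iter t tau_seq (rcons s x)) = (v + U_(Ordinal kn))%MM.
  by rewrite iter_tau_rcons -cats1 mon_cat -mon_ord.
(* The spread gaps up to [x] show that no entry of [iter t tau_seq s] exceeds [k]. *)
have vk (j : 'I_n) : (k < j)%N -> (v + U_(Ordinal kn))%MM j = 0%N.
  move=> kj; rewrite mnmDE mnm1E -val_eqE /= (ltn_eqF kj) addn0 mnmE.
  apply/count_memPn/(nthP 0%N) => -[i]; rewrite size_iter_tau nth_iter_tau => si e.
  have := spread_gap st (ltnW si); rewrite size_rcons => /(_ (ltnSn _)).
  rewrite nth_rcons_size nth_rcons si mulnBl => gap.
  have : (i * t <= size s * t)%N by rewrite leq_mul2r ltnW ?orbT.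
  have := spread_gap st (leq0n (size s)); rewrite size_rcons => /(_ (ltnSn _)).
  rewrite nth_rcons_size subn0.
  by move: kj; rewrite -e /k; lia.
have hE m : (forall j : 'I_n, (k < j)%N -> m j = 0%N) -> h@_m = ('X_(Ordinal kn) * f)@_m.
  by move=> mk; have := Dh m mk; rewrite mcoeffB => /eqP; rewrite subr_eq0 => /eqP.
split=> [|u uh uv]; first by rewrite mcoeff_msupp hE // mcoeff_mulXU -mcoeff_msupp.
have du : mdeg u = mdeg (v + U_(Ordinal kn))%MM.
  rewrite (dhomogP _ _ _ hh _ uh) mdegD mdeg1 mdeg_mon ?size_iter_tau ?addn1 //.
  apply/(all_nthP 0%N) => i; rewrite size_iter_tau nth_iter_tau => si.
  by have := all_nthP 0%N bs' i si; lia.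
(* A monomial of [h] with a variable past [k] is smaller by [revlex_last]; on the other monomials
   [h] agrees with the product of [f] and the variable of index [k]. *)
have [/existsP[j /andP[kj uj]]|] := boolP [exists j : 'I_n, (k < j)%N && (0 < u j)%N].
  exact: revlex_last du vk kj uj.
rewrite negb_exists => /forallP noj.
have uk (j : 'I_n) : (k < j)%N -> u j = 0%N.
  by move=> kj; have := noj j; rewrite kj /= -eqn0Ngt => /eqP.
move: uh; rewrite mcoeff_msupp hE // -mcoeff_msupp mulrC (perm_mem (msuppMX _ _)).
move=> /mapP[u' fu' e]; rewrite e addmC in uv *.
by apply/revlex_add/f2 => //; apply: contra uv => /eqP->.
Qed.

End Leading.

(** * Counting monomials *)

Section InitialCount.
Local Open Scope ring_scope.

Variables (K : fieldType) (n : nat) (g : 'M[K]_n).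
Implicit Types (I : set {mpoly K[n]}) (f h : {mpoly K[n]}) (m u v : 'X_{1..n}).

Local Notation phi := (lin_subst g).

Lemma lin_substE h : phi h = \sum_(m <- msupp h) h@_m *: phi 'X_[m].
Proof.
rewrite {1}(mpolyE h) /lin_subst raddf_sum; apply: eq_bigr => m _.
by rewrite /= comp_mpolyZ.
Qed.

Lemma lin_subst_coef0 h u :
  (forall m, m \in msupp h -> mdeg m != mdeg u) -> (phi h)@_u = 0.
Proof.
move=> hu; rewrite lin_substE raddf_sum big_seq /= big1 // => m /hu mu.
rewrite mcoeffZ (dhomog_nemf_coeff (lin_subst_homog g m)) ?mulr0 //.
by rewrite eq_sym.
Qed.

(* A linear change of coordinates preserves degrees, so the terms of h of degree
   at least d do not matter for the initial monomial. *)
Lemma initial_truncation h d v : (mdeg v < d)%N -> initial_monomial (phi h) v ->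
  initial_monomial (\sum_(m : 'X_{1..n < d}) h@_m *: phi 'X_[m]) v.
Proof.
move=> vd [vh hv].
pose h1 : {mpoly K[n]} := \sum_(m : 'X_{1..n < d}) h@_m *: 'X_[m].
have -> : \sum_(m : 'X_{1..n < d}) h@_m *: phi 'X_[m] = phi h1.
  rewrite /lin_subst raddf_sum; apply: eq_bigr => m _ /=.
  by rewrite /= comp_mpolyZ.
have h1E m : h1@_m = if (mdeg m < d)%N then h@_m else 0.
  case: ifP => md; first exact: (mcoeff_mpoly (fun m => h@_m)).
  rewrite raddf_sum big1 // => w _ /=; rewrite mcoeffZ mcoeffX.
  case: eqP => [e|_]; last by rewrite mulr0.
  by move: md; rewrite -e bmdeg.
have small u : (mdeg u < d)%N -> (phi h1)@_u = (phi h)@_u.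
  move=> ud; apply/eqP; rewrite eq_sym -subr_eq0 -mcoeffB -raddfB /=; apply/eqP.
  apply: lin_subst_coef0 => m; rewrite mcoeff_msupp mcoeffB h1E.
  case: ltnP => [_|dm _]; first by rewrite subrr eqxx.
  by apply: contraTneq ud => <-; rewrite -leqNgt.
have large u : (d <= mdeg u)%N -> (phi h1)@_u = 0.
  move=> du; apply: lin_subst_coef0 => m; rewrite mcoeff_msupp h1E.
  case: ltnP => [md _|_]; last by rewrite eqxx.
  by apply: contraTneq du => <-; rewrite -ltnNge.
split=> [|u]; first by rewrite mcoeff_msupp small // -mcoeff_msupp.
have [ud|du] := ltnP (mdeg u) d; last by rewrite mcoeff_msupp large // eqxx.
by rewrite mcoeff_msupp small // -mcoeff_msupp => /hv.
Qed.

Definition monos_below I d : {set 'X_{1..n < d}} :=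
  [set v : 'X_{1..n < d} | `[< I 'X_[v] >]].

Definition initials_below I d : {set 'X_{1..n < d}} :=
  [set v : 'X_{1..n < d} | `[< exists2 f, I f & initial_monomial f v >]].

(** Each initial monomial is attained by a combination of the images of the monomials in [B]. With
    more initial monomials than elements of [B] these combinations would satisfy a linear relation,
    but the largest initial monomial in it cannot cancel. *)
Lemma card_initials_below (M : set 'X_{1..n}) d (I := monomial_ideal M) :
  (#|initials_below (phi @` I) d| <= #|monos_below I d|)%N.
Proof.
set R := initials_below _ d; set B := monos_below I d.
have exa (v : 'X_{1..n < d}) : exists a : 'X_{1..n < d} -> K,
    v \in R -> initial_monomial (\sum_(w in B) a w *: phi 'X_[w]) v.
  have [|nv] := boolP (v \in R); last by exists (fun=> 0).
  rewrite inE => /asboolP[_ [h Ih <-] hv]; exists (fun w => h@_w) => _.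
  have := initial_truncation (bmdeg v) hv.
  rewrite (bigID (mem B)) /= [X in _ + X]big1 ?addr0 // => w wB.
  rewrite memN_msupp_eq0 ?scale0r //; apply: contra wB => wh.
  rewrite inE; apply/asboolP/monomial_idealX.
  by move: Ih; rewrite /I monomial_idealE => /(_ _ wh).
have [a ha] := choice exa.
rewrite leqNgt; apply/negP => BR.
pose A : 'M[K]_(#|R|, #|B|) := \matrix_(i, j) a (enum_val i) (enum_val j).
have : kermx A != 0.
  rewrite kermx_eq0 /row_free; apply: contraL BR => /eqP <-.
  by rewrite -leqNgt rank_leq_col.
move=> /rowV0Pn[c /sub_kermxP cA c0].
pose F i := \sum_(w in B) a (@enum_val _ (mem R) i) w *: phi 'X_[w].
have F0 : \sum_i c 0 i *: F i = 0.
  under eq_bigr => i _ do rewrite /F scaler_sumr.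
  rewrite exchange_big big_enum_val /= big1 // => j _.
  under eq_bigr => i _ do rewrite scalerA.
  rewrite -scaler_suml; have /matrixP/(_ 0 j) := cA; rewrite !mxE.
  under eq_bigr => i _ do rewrite mxE.
  by move=> ->; rewrite scale0r.
have FR i : initial_monomial (F i) (enum_val i) by apply/ha/enum_valP.
have /rV0Pn[i0 ci0] := c0.
(* The number of monomials above [v]; minimising it selects a maximal initial monomial of the
   relation. *)
pose rk (v : 'X_{1..n < d}) := #|[set x : 'X_{1..n < d} | revlex_lt v x]%SET|.
case: (@arg_minnP _ i0 (fun i => c 0 i != 0) (fun i => rk (enum_val i)) ci0).
move=> i ci imin.
have := congr1 (mcoeff (enum_val i : 'X_{1..n < d})) F0.
rewrite mcoeff0 raddf_sum (bigD1 i) //= big1 => [|l li].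
  rewrite addr0 mcoeffZ => /eqP; rewrite mulf_eq0 (negPf ci) /=.
  by have [] := FR i; rewrite mcoeff_msupp => /negPf->.
rewrite mcoeffZ; have [->|cl] := eqVneq (c 0 l) 0; first by rewrite mul0r.
rewrite memN_msupp_eq0 ?mulr0 //; apply/negP => il.
have [_ /(_ _ il)] := FR l; rewrite (inj_eq val_inj) (inj_eq enum_val_inj) eq_sym li.
move=> /(_ isT) lt; have := imin l cl; rewrite leqNgt => /negP; apply.
apply: proper_card; apply/properP; split.
  by apply/fintype.subsetP => x; rewrite !inE; apply: revlex_trans.
by exists (enum_val l); rewrite !inE ?revlex_irr.
Qed.

End InitialCount.

(** * An injection between the monomials of the two ideals *)

Section Transfer.
Local Open Scope ring_scope.

Variables (t n : nat) (G : set (seq nat)).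
Hypothesis GG : stable_gens t G.
Hypothesis Gb : forall s, G s -> all (fun i => i < n)%N s.

Local Notation bounded := (all (fun i => i < n)%N).
Local Notation tau := (iter t tau_seq).

(* The monomials w of I are the products of some u in G with a monomial in the
   variables free u, and there are as many of these as variables from the last
   one of tau u on; freeze u matches them. *)
Definition free u : seq nat :=
  blocks t (take (size u).-1 u) ++ iota (last 0%N u) (n - last 0%N u).

Definition freeze u c : nat := last 0%N (tau u) + index c (free u).

(** The length of [free u], [(size u).-1 * t + (n - last 0 u)], is exactly [n - last 0 (tau u)]. For
    empty [u] both are [n]. *)
Lemma freeze_lt u c : G u -> c \in free u -> (freeze u c < n)%N.
Proof.
move=> Gu cu; have [Gt _ _] := GG.
have /leq_trans : (freeze u c < last 0 (tau u) + size (free u))%N.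
  by rewrite ltn_add2l index_mem.
apply; rewrite size_cat size_blocks size_iota -!nth_last size_iter_tau nth_iter_tau.
rewrite size_takel ?leq_pred //.
case: u Gu {cu} => [|x u] Gu /=; first by rewrite !mul0n !add0n !subn0.
have := spread_gap (Gt _ Gu) (leq0n (size u)) (ltnSn _); rewrite subn0.
by have := all_nthP 0%N (Gb Gu) (size u) (ltnSn _); rewrite /=; lia.
Qed.

Lemma freeze_inj u r1 r2 : {subset r1 <= free u} -> {subset r2 <= free u} ->
  perm_eq (map (freeze u) r1) (map (freeze u) r2) -> perm_eq r1 r2.
Proof.
pose unfreeze y := nth 0%N (free u) (y - last 0%N (tau u)).
have K r : {subset r <= free u} -> map unfreeze (map (freeze u) r) = r.
  move=> h; rewrite -map_comp map_id_in // => c /h cf.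
  by rewrite /= /unfreeze /freeze addKn nth_index.
by move=> h1 h2 /(perm_map unfreeze); rewrite !K.
Qed.

(** The greedy subsequence [p] of [w] starts below [s], so a prefix of it is in [G]; take that
    prefix as [u]. Later entries of [p] are at least the last entry of [u], and skipped entries lie
    in blocks of [p]: in one of an earlier entry of [u], or from the last entry of [u] on. *)
Lemma free_decomposition w s : sorted leq w -> bounded w -> G s -> subseq s w ->
  exists u r, [/\ G u, perm_eq w (u ++ r) & {subset r <= free u}].
Proof.
move=> sw bw Gs sub; have [Gt Gle _] := GG.
have [p [r [pe [sp _] rb pmin]]] := greedy_spread t 0 sw.
have le : cwle (take (size s) p) s by apply: pmin => //; apply: Gt.
have [k0] := Gle _ _ Gs le (spread_take _ sp); rewrite -take_min.
set k := minn _ _ => Gu; exists (take k p), (drop k p ++ r).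
split=> [//||c cr]; first by rewrite catA cat_take_drop.
have cn : (c < n)%N.
  apply: (allP bw); rewrite (perm_mem pe) mem_cat.
  by move: cr; rewrite mem_cat => /orP[/mem_drop ->|->]; rewrite ?orbT.
have drop_last i : i \in drop k p -> (last 0%N (take k p) <= i)%N.
  case/lastP: (take k p) (cat_take_drop k p) => // q x e id.
  move: (spread_sorted sp); rewrite -{1}e (sorted_pairwise leq_trans) pairwise_cat.
  move=> /and3P[/allrelP h _ _]; rewrite last_rcons; apply: h => //.
  by rewrite mem_rcons mem_head.
suff : (last 0%N (take k p) <= c)%N \/
    c \in blocks t (take (size (take k p)).-1 (take k p)).
  by case=> h; rewrite mem_cat ?h // mem_iota; apply/orP; right; lia.
move: cr; rewrite mem_cat => /orP[/drop_last|/rb[//|]]; first by left.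
move=> /mem_blocks[i ip ci]; move: ip; rewrite -{1}(cat_take_drop k p) mem_cat.
case/orP=> [|/drop_last]; last by left; lia.
case/lastP: (take k p) => // q x; rewrite mem_rcons inE last_rcons size_rcons /=.
rewrite -cats1 take_size_cat // => /orP[/eqP xi|iq]; first by left; lia.
by right; apply/mem_blocks; exists i.
Qed.

(** A relation, as the decomposition of [w] is only known to exist; a function is chosen from it
    when counting. *)
Definition transfer (w z : 'X_{1..n}) : Prop :=
  exists u r, [/\ G u, {subset r <= free u}, bounded r, w = mon n (u ++ r)
    & z = mon n (tau u ++ map (freeze u) r)].

Lemma bounded_transfer u r : G u -> {subset r <= free u} ->
  bounded (tau u ++ map (freeze u) r).
Proof.
move=> Gu rf; rewrite all_cat; apply/andP; split.
  exact/bounded_iter_tau/Gb.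
by apply/allP => _ /mapP[c /rf cf ->]; apply: freeze_lt.
Qed.

(** Frozen entries are at least the last entry of [tau u], so sorting leaves [tau u] in front. *)
Lemma transfer_prefix u r : G u -> {subset r <= free u} ->
  take (size u) (indices (mon n (tau u ++ map (freeze u) r))) = tau u.
Proof.
move=> Gu rf; have [Gt _ _] := GG.
set z := mon n _; have stau := spread_iter_tau (Gt _ Gu).
have -> : indices z = tau u ++ sort leq (map (freeze u) r).
  have pe : perm_eq (tau u ++ map (freeze u) r) (tau u ++ sort leq (map (freeze u) r)).
    by rewrite perm_cat2l perm_sym perm_sort.
  rewrite /z (mon_perm n pe) monK //; last by rewrite -(perm_all _ pe) bounded_transfer.
  rewrite (sorted_pairwise leq_trans) pairwise_cat -!(sorted_pairwise leq_trans).
  rewrite stau (sort_sorted leq_total) !andbT; apply/allrelP => x y.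
  rewrite mem_sort => xu /mapP[c _ ->]; apply: leq_trans (leq_addr _ _).
  case/lastP: (tau u) stau xu => // q l.
  rewrite -cats1 (sorted_pairwise leq_trans) pairwise_cat last_cat /=.
  move=> /and3P[/allrelP h _ _]; rewrite mem_cat inE => /orP[xq|/eqP->//].
  by apply: h; rewrite ?inE.
by rewrite -(size_iter_tau t u) take_size_cat.
Qed.

Lemma transfer_inj w1 w2 z : transfer w1 z -> transfer w2 z -> w1 = w2.
Proof.
have [Gt _ Gp] := GG.
move=> [u1 [r1 [Gu1 f1 b1 -> e1]]] [u2 [r2 [Gu2 f2 b2 -> e2]]].
wlog le : u1 u2 r1 r2 Gu1 Gu2 f1 f2 b1 b2 e1 e2 / (size u1 <= size u2)%N.
  move=> H; case: (leqP (size u1) (size u2)) => [|/ltnW] le; first exact: H.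
  by apply/esym; apply: H.
have eu : u1 = u2.
  have p1 := transfer_prefix Gu1 f1; have p2 := transfer_prefix Gu2 f2.
  rewrite -e1 in p1; rewrite -e2 in p2.
  have : tau (take (size u1) u2) = tau u1.
    by rewrite take_iter_tau -p2 -take_min (minn_idPl le).
  move=> /(congr1 (iter t sigma_seq)).
  rewrite !iter_sigma_tau ?spread_take ?Gt // => e.
  by rewrite -e; apply: Gp => //; rewrite e.
subst u2; rewrite !mon_cat; congr (_ + _)%MM; apply/mon_perm/(freeze_inj f1 f2).
rewrite -(perm_cat2l (tau u1)); apply: (@mon_inj n); rewrite ?bounded_transfer //.
by rewrite -e1 -e2.
Qed.

Lemma card_monos_below (K : fieldType) d :
  (#|monos_below (gens_ideal K n G) d|
     <= #|monos_below (gens_ideal K n (tau @` G)) d|)%N.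
Proof.
have [Gt _ _] := GG.
have ex (w : 'X_{1..n < d}) : exists z : 'X_{1..n < d},
    w \in monos_below (gens_ideal K n G) d ->
    z \in monos_below (gens_ideal K n (tau @` G)) d /\ transfer w z.
  have [|nw] := boolP (w \in monos_below (gens_ideal K n G) d); last by exists w.
  rewrite inE -(indicesK w) => /asboolP/gens_idealX[||s Gs|s Gs sub] //.
  - exact: indices_sorted.
  - by move=> s /Gt/spread_sorted.
  - exact: Gb.
  have [u [r [Gu pe rf]]] :=
    free_decomposition (indices_sorted _) (indices_bounded _) Gs sub.
  have br : bounded r.
    by move: (indices_bounded w); rewrite (perm_all _ pe) all_cat => /andP[].
  pose z := mon n (tau u ++ map (freeze u) r).
  have zd : (mdeg z < d)%N.
    rewrite mdeg_mon ?bounded_transfer // size_cat size_map size_iter_tau.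
    by rewrite -size_cat -(perm_size pe) size_indices bmdeg.
  exists (BMultinom zd) => _; split.
    rewrite inE; apply/asboolP/monomial_idealX; exists (mon n (tau u)).
      by exists (tau u) => //; exists u.
    exact/subseq_mon/prefix_subseq.
  by exists u, r; split=> //; rewrite -(mon_perm n pe) indicesK.
have [F FP] := choice ex.
rewrite -(@card_in_imset _ _ F); last first.
  move=> w1 w2 /FP[_ h1] /FP[_ h2] e; apply/val_inj.
  by rewrite e in h1; apply: transfer_inj h1 h2.
by apply/subset_leq_card/fintype.subsetP => _ /imsetP[w /FP[Fw _] ->].
Qed.

End Transfer.

(** * The generic initial ideal *)

Section Gin.
Local Open Scope ring_scope.

Variables (K : fieldType) (n : nat).
Hypothesis charK : [pchar K] =i pred0.
Implicit Types (I J : set {mpoly K[n]}) (g : 'M[K]_n).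

(** The product of polynomials witnessing the two open sets and of the one from [generic_open] is
    nonzero at some matrix, which is invertible and lies in both sets. *)
Lemma is_gin_unique I J1 J2 : is_gin I J1 -> is_gin I J2 -> J1 = J2.
Proof.
have [p [[x px] pU]] := generic_open charK n.
move=> [_ [[P1 ->] [g1 [_ [p1 Pp1 g1p]]] H1]] [_ [[P2 ->] [g2 [_ [p2 Pp2 g2p]]] H2]].
have [y py] := common_nonzero charK g1p g2p.
have [z] := common_nonzero charK px py.
have [g <-] := mxvec_surj z; rewrite !mevalM !mulf_eq0 !negb_or => /and3P[gp h1 h2].
have [gu _] := pU g gp.
by rewrite -(H1 g) ?(H2 g) //; split=> //; [exists p2|exists p1].
Qed.

Lemma Gin_unique I J : is_gin I J -> Gin I = J.
Proof.
by move=> IJ; apply: xget_unique => // J' IJ'; apply: is_gin_unique IJ' IJ.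
Qed.

Lemma image_subspace g I : is_ideal I -> is_subspace (lin_subst g @` I).
Proof.
move=> idI; have [I0 ID _] := idI; split.
- by exists 0 => //; rewrite /lin_subst raddf0.
- move=> _ _ [f If <-] [h Ih <-]; exists (f + h); first exact: ID.
  by rewrite /lin_subst raddfD.
- move=> c _ [f If <-]; exists (c *: f); first exact: is_idealZ.
  by rewrite /lin_subst comp_mpolyZ.
Qed.

(** The forms of all [n] indices span the variables. Surjectivity makes the image of an ideal closed
    under multiplication by arbitrary polynomials. *)
Lemma lin_subst_surj g p : generic_mx g -> exists h, lin_subst g h = p.
Proof.
move=> gg.
have XI (i : 'I_n) : exists h, lin_subst g h = 'X_i.
  have idT : is_ideal [set: {mpoly K[n]}] by [].
  suff : (lin_subst g @` setT) 'X_i by case=> h _ <-; exists h.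
  apply: (generic_span gg (iota_uniq 0 n) _ (image_subspace g idT)).
  - by apply/allP => c; rewrite mem_iota.
  - by move=> c _; exists 'X_[mon n [:: c]].
  - by move=> j; rewrite size_iota leqNgt ltn_ord.
have Xm m : exists h, lin_subst g h = 'X_[m].
  rewrite -(indicesK m); elim: indices (indices_bounded m) => [_|c s IH].
    by exists 1; rewrite mon_nil mpolyX0 /lin_subst rmorph1.
  move=> /andP[cn /IH[h1 e1]]; have [h2 e2] := XI (Ordinal cn).
  exists (h2 * h1); rewrite -cat1s mon_cat mpolyXD -e1 (mon_ord (Ordinal cn)) -e2.
  by rewrite /lin_subst rmorphM.
rewrite (mpolyE p); elim: (msupp p) => [|m r [h IH]].
  by exists 0; rewrite big_nil /lin_subst raddf0.
have [hm em] := Xm m; exists (p@_m *: hm + h).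
by rewrite big_cons -IH -em /lin_subst raddfD /= comp_mpolyZ.
Qed.

Lemma initial_monomial_mul f m w :
  initial_monomial f m -> initial_monomial ('X_[w] * f : {mpoly K[n]}) (m + w)%MM.
Proof.
move=> [fm fmax]; rewrite mulrC; split=> [|u].
  by rewrite mcoeff_msupp addmC mcoeffMX -mcoeff_msupp.
rewrite (perm_mem (msuppMX _ _)) => /mapP[u' /fmax h ->]; rewrite addmC.
by rewrite eqm_add2r => /h; apply: revlex_add.
Qed.

Lemma initial_ideal_generic t G g : stable_gens t G ->
  (forall s, G s -> all (fun i => i < n)%N s) -> generic_mx g ->
  initial_ideal (lin_subst g @` gens_ideal K n G) =
  gens_ideal K n (iter t tau_seq @` G).
Proof.
move=> GG Gb gg; have [Gt Gle _] := GG.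
set I := gens_ideal K n G; set J := gens_ideal K n _.
have idI : is_ideal I by apply: ideal_gen_is_ideal.
have init_tau s : G s -> exists2 f, (lin_subst g @` I) f &
    initial_monomial f (mon n (iter t tau_seq s)).
  move=> Gs; have [|f [If _ fi]] := leading_monomial gg (Gt _ Gs) (Gb _ Gs)
    (image_subspace g idI); last by exists f.
  move=> s' st le; exists 'X_[mon n s'] => //.
  have [k Gk] := Gle _ _ Gs le st; apply/monomial_idealX.
  by exists (mon n (take k s')); [exists (take k s')|exact/subseq_mon/take_subseq].
apply/seteqP; split=> f; rewrite /initial_ideal /J /gens_ideal !monomial_idealE.
  move=> fM m /fM[u [h Ih hu] um].
  suff : J 'X_[u].
    rewrite /J /gens_ideal monomial_idealX => -[v Jv vu].
    by exists v => //; apply: lepm_trans um.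
  pose d := (mdeg u).+1.
  have JR : monos_below J d \subset initials_below (lin_subst g @` I) d.
    apply/fintype.subsetP => v; rewrite !inE /J /gens_ideal.
    rewrite monomial_idealX => -[_ [_ [s Gs <-] <-] le].
    have [_ [h' Ih' <-] hi] := init_tau s Gs.
    have [q eq] := lin_subst_surj 'X_[v - mon n (iter t tau_seq s)] gg.
    have [_ _ IM] := idI.
    exists ('X_[v - mon n (iter t tau_seq s)] * lin_subst g h').
      by exists (q * h'); [apply: IM|rewrite -eq /lin_subst rmorphM].
    by rewrite -{2}(submK le) addmC; apply: initial_monomial_mul.
  (* The inclusion is an equality, because the initial monomials are at most as many as the
     monomials of [I], and these at most as many as those of [J]. *)
  have : monos_below J d == initials_below (lin_subst g @` I) d.
    rewrite eqEcard JR; apply: leq_trans (card_initials_below _ _ _) _.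
    exact: card_monos_below.
  move=> /eqP/setP/(_ (BMultinom (ltnSn (mdeg u)))); rewrite !inE => e.
  by apply/asboolP; rewrite e; apply/asboolP; exists h.
move=> fJ m /fJ[_ [_ [s Gs <-] <-] um].
by exists (mon n (iter t tau_seq s)) => //; apply: init_tau.
Qed.

Lemma Gin_gens_ideal t G : stable_gens t G ->
  (forall s, G s -> all (fun i => i < n)%N s) ->
  Gin (gens_ideal K n G) = gens_ideal K n (iter t tau_seq @` G).
Proof.
move=> GG Gb; apply: Gin_unique.
have [p [[x px] pU]] := generic_open charK n.
exists [set g | g \in unitmx /\ exists2 q, [set p] q & q.@[mxvec g 0] != 0].
split; first by exists [set p].
- have [g gx] := mxvec_surj x; rewrite -gx in px.
  by exists g; split; [have [] := pU g px|exists p].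
- by move=> g [_ [_ -> /pU[_ gg]]]; apply: initial_ideal_generic.
Qed.

End Gin.

Theorem theorem4p1 (K : fieldType) (charK : [pchar K]%R =i pred0) (t n : nat) :
  (forall I : set {mpoly K[n]}, tspread_strongly_stable t I ->
     exists N0 : nat, forall N : nat, (N0 <= N)%N ->
       in_vars N I = sigma_ideal t (in_vars N (Gin I)) /\
       in_vars N (Gin I) = tau_ideal t (in_vars N I)) /\
  (forall I : set {mpoly K[n]}, tspread_strongly_stable 0 I ->
     exists N0 : nat, forall N : nat, (N0 <= N)%N ->
       Gin (sigma_ideal t (in_vars N I)) = in_vars N I).
Proof.
split=> I /strongly_stable_gens[G [GG Gb ->]].
  (* Here [n] variables suffice: tau only lowers indices, and sigma merely undoes it. *)
  exists n => N nN; have [Gt _ _] := GG.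
  have GN s : G s -> all (fun i => i < N)%N s.
    by move=> /Gb; apply: sub_all => i /leq_trans; apply.
  have G0 := stable_gens_iter_tau GG.
  have G0b m : (forall s, G s -> all (fun i => i < m)%N s) ->
      forall s, (iter t tau_seq @` G) s -> all (fun i => i < m)%N s.
    by move=> Gm _ [s /Gm ? <-]; apply: bounded_iter_tau.
  rewrite (Gin_gens_ideal charK GG Gb) (in_vars_gens_ideal _ GG Gb GN).
  rewrite (in_vars_gens_ideal _ G0 (G0b n Gb) (G0b N GN)) (tau_gens_ideal _ GG GN).
  have e : iter t sigma_seq @` (iter t tau_seq @` G) = G.
    rewrite image_comp; apply/seteqP; split=> [_ [s Gs <-]|s Gs] /=.
      by rewrite iter_sigma_tau // Gt.
    by exists s => //=; rewrite iter_sigma_tau // Gt.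
  split=> //; rewrite sigma_gens_ideal ?e // => _ [s Gs <-].
  by rewrite iter_sigma_tau ?GN ?Gt.
have [D GD] := stable_gens_size_bound n GG.
(* Sigma iterated [t] times raises the entry at position [i] by [i * t], and generators have length
   at most [D]. *)
exists (n + D * t)%N => N nN.
have GN s : G s -> all (fun i => i < N)%N s.
  by move=> /Gb; apply: sub_all => i; lia.
have GNs s : G s -> all (fun i => i < N)%N (iter t sigma_seq s).
  move=> Gs; apply/(all_nthP 0%N) => i.
  rewrite -(size_iter_tau t) iter_tau_sigma => si.
  have := nth_iter_tau t (iter t sigma_seq s) i; rewrite iter_tau_sigma.
  have := all_nthP 0%N (Gb _ Gs) i si; have := GD s Gs (Gb s Gs).
  move=> sD; have : (i * t <= D * t)%N by rewrite leq_mul2r (leq_trans (ltnW si)) ?orbT.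
  by lia.
rewrite (in_vars_gens_ideal _ GG Gb GN) (sigma_gens_ideal _ GG GNs).
(* The shifted generators satisfy the conditions for [t], so taking [Gin] applies tau [t] times,
   which undoes the shift. *)
rewrite (Gin_gens_ideal charK (stable_gens_iter_sigma t GG)); last first.
  by move=> _ [s Gs <-]; apply: GNs.
congr gens_ideal; rewrite image_comp; apply/seteqP; split=> [_ [s Gs <-]|s Gs] /=.
  by rewrite iter_tau_sigma.
by exists s => //=; rewrite iter_tau_sigma.
Qed.
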